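(* Let $\alpha\ge3$ and $\kappa\ge\omega$ be cardinals, and let $\{X_i:i\in I\}$ be a set of topological spaces such that $|I|^+\ge\kappa$ and $d(X_i)\le\alpha\le S(X_i)$ for each $i\in I$. Consider these conditions: (i) $\alpha$ is regular; (ii) $\alpha=\alpha^{<\kappa}$; (iii) $\kappa\ll\alpha$; (iv) $S((X_J)_\kappa)=\alpha$ for all nonempty $J\subseteq I$ with $|J|<\kappa$. Then: (a) if conditions (i), (ii), (iii) and (iv) all hold, then $S((X_I)_\kappa)=\alpha^{<\kappa}=\alpha$; and (b) if one (or more) of conditions (i), (ii), (iii), (iv) fails, then $S((X_I)_\kappa)=(\alpha^{<\kappa})^+$.
   Context: No separation axioms are assumed. $d(X)$ is the density character of $X$ (least cardinality of a dense subset). A cellular family in $X$ is a family of pairwise disjoint nonempty open subsets of $X$; the Souslin number $S(X)$ is the least cardinal $\lambda$ such that no cellular family in $X$ has cardinality $\lambda$. Finite values of $d$ and $S$ are allowed. For a set $J$ of indices, $X_J:=\prod_{i\in J}X_i$, and for an infinite cardinal $\kappa$, $(X_J)_\kappa$ is $X_J$ with the $\kappa$-box topology, whose base consists of all sets $\prod_{i\in J}U_i$ with each $U_i$ open in $X_i$ and $|\{i\in J:U_i\ne X_i\}|<\kappa$. $\alpha^{<\kappa}:=\sum_{\lambda<\kappa}\alpha^\lambda$ (sum over cardinals $\lambda<\kappa$). For a cardinal $\gamma$ (finite or infinite), $\gamma^+$ is the least cardinal greater than $\gamma$. $\kappa\ll\alpha$ (''$\alpha$ is strongly $\kappa$-inaccessible'')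 means: $\kappa<\alpha$, and $\beta^\lambda<\alpha$ whenever $\beta<\alpha$ and $\lambda<\kappa$ are cardinals. *)

(* Defs.v *)
From HB Require Import structures.
From mathcomp Require Import all_boot.
From mathcomp Require Import all_classical topology_structure.

Set Implicit Arguments.
Unset Strict Implicit.
Unset Printing Implicit Defensive.

Local Open Scope classical_set_scope.
Local Open Scope card_scope.

(* A cardinal is represented by a type [A], up to equipotence, and
   cardinals are compared through [#<=], [#=] and [#<] between the full sets
   [[set: A]].  The power of [B] to [L] is the function type [L -> B]. *)

Reserved Notation "A '#<' B" (at level 79, format "A  '#<'  B").

Definition card_lt T U (A : set T) (B : set U) := (A #<= B) && (A #!= B).
Notation "A '#<' B" := (card_lt A B) : card_scope.

Lemma inj_cardT (T U : Type) (f : T -> U) :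
  injective f -> [set: T] #<= [set: U].
Proof.
move=> fI; apply: (card_le_trans _ (card_leT (f @` setT))).
have h : f @` setT #= [set: T] by apply: inj_card_eq => x y _ _; apply: fI.
by rewrite (card_le_eqr h) card_lexx.
Qed.

Lemma cardT_inj (T U : Type) :
  [set: T] #<= [set: U] -> exists f : T -> U, injective f.
Proof.
move=> /card_leP[f].
have tT (t : T) : t \in [set: T] by rewrite inE.
exists (fun t => val (f (SigSub (tT t)))) => x y /val_inj e.
have := 'inj_f; move=> /(_ (SigSub (tT x)) (SigSub (tT y))).
by rewrite !inE => /(_ Logic.I Logic.I e) [].
Qed.

Lemma cardT_min (J : Type) (F : J -> Type) (j0 : J) :
  exists j, forall k, [set: F j] #<= [set: F k].
Proof.
pose P : set (set (forall j, F j)) := [set W | forall w w' j,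
  W w -> W w' -> w j = w' j -> w = w'].
have [|W [PW maxW]] := @Zorn_bigcup _ P.
  move=> Fs sub tot w w' j [A FA Aw] [B FB Bw'].
  have [AB|BA] := tot _ _ FA FB; first exact: (sub _ FB) (AB _ Aw) Bw'.
  exact: (sub _ FA) Aw (BA _ Bw').
have [[j jW]|noj] := pselect (exists j, forall a, exists2 w, W w & w j = a).
  exists j => k.
  have /choice[s sP] : forall a : F j, exists w, W w /\ w j = a.
    by move=> a; have [w ? ?] := jW a; exists w.
  apply: (@inj_cardT _ _ (fun a => s a k)) => a b e.
  have [Wa <-] := sP a; have [Wb <-] := sP b.
  by rewrite (PW _ _ _ Wa Wb e).
have /all_sig[g gP] : forall j, {a : F j | forall w, W w -> w j <> a}.
  move=> j; apply: cid; apply: contrapT => h; apply: noj; exists j => a.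
  apply: contrapT => h'; apply: h; exists a => w Ww e.
  by apply: h'; exists w.
exfalso; apply: (maxW (W `|` [set g])).
  split; first by move=> w Ww; left.
  by move=> /(_ g (or_intror erefl)) Wg; apply: (gP j0 g Wg).
move=> w w' j [Ww|->] [Ww'|->] //; first exact: PW.
- by move=> e; case: (gP j w Ww).
- by move=> /esym e; case: (gP j w' Ww').
Qed.

Lemma card_le_totalT (T U : Type) :
  [set: T] #<= [set: U] \/ [set: U] #<= [set: T].
Proof.
have [b bP] := @cardT_min bool (fun b => if b then T else U) true.
by case: b bP => bP; [left; exact: (bP false)|right; exact: (bP true)].
Qed.

(* The least cardinal satisfying [P]; the default [void] is never reached in the
   uses below, see [succ_cardP], [cofP], [densityP] and [souslinP]. *)
Definition least_card (P : Type -> Prop) : Type :=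
  if pselect (exists A, P A /\ forall B, P B -> [set: A] #<= [set: B])
  is left h then projT1 (cid h) else void.

Lemma least_cardP (P : Type -> Prop) :
    (forall A B : Type, [set: A] #= [set: B] -> P A -> P B) ->
    (exists A, P A) ->
  P (least_card P) /\ forall B, P B -> [set: least_card P] #<= [set: B].
Proof.
move=> Peq [A0 PA0]; rewrite /least_card.
case: pselect => [h|[]]; first by case: (cid h).
pose J := {A : set A0 | P A}.
have P0 : P [set: A0] by apply: Peq PA0; exact/card_esym/card_setT.
have [[A PA] minA] := @cardT_min J (fun j => projT1 j) (exist _ _ P0).
exists A; split => // B PB.
have [le0B|leB0] := card_le_totalT A0 B.
  apply: card_le_trans le0B; apply: card_le_trans (card_leT A).
  by rewrite (card_le_eql (card_setT A)) card_lexx.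
have /card_subP[C CB _] := leB0.
have CB' : [set: C] #= [set: B] by rewrite (card_eql (card_setT C)).
have PC : P C by apply: Peq PB; exact/card_esym.
by rewrite -(card_le_eqr CB'); exact: (minA (exist _ C PC)).
Qed.

Lemma card_ltNle T U (A : set T) (B : set U) : A #< B <-> ~ (B #<= A).
Proof.
have tot : A #<= B \/ B #<= A.
  have := card_le_totalT A B.
  by rewrite !(card_le_eql (card_setT _)) !(card_le_eqr (card_setT _)).
rewrite /card_lt card_eq_le; split.
  by move=> /andP[-> ] /=; exact/negP.
by case: tot => [-> /= /negP|//].
Qed.

Lemma cardT_double (T : Type) :
  [set: nat] #<= [set: T] -> [set: T * bool] #<= [set: T].
Proof.
move=> Tinf.
pose P : set (set (nat -> T)) := [set W | (forall f, W f -> injective f) /\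
  forall f g m n, W f -> W g -> f m = g n -> f = g].
have [|W [[Winj Wdisj] maxW]] := @Zorn_bigcup _ P.
  move=> Fs sub tot; split=> [f [A FA Af]|f g m n [A FA Af] [B FB Bg]].
    exact: (sub _ FA).1.
  have [AB|BA] := tot _ _ FA FB; first exact: (sub _ FB).2 (AB _ Af) Bg.
  exact: (sub _ FA).2 Af (BA _ Bg).
pose R := [set t | forall f n, W f -> f n <> t].
have finR : finite_set R.
  apply: contrapT => /infiniteP; rewrite -(card_le_eqr (card_setT R)).
  move=> /cardT_inj[s0 s0I]; pose s n := val (s0 n).
  have sI : injective s by move=> m n /val_inj/s0I.
  have sR n : R (s n) by rewrite /s; exact: set_valP.
  apply: (maxW (W `|` [set s])); split.
  - by move=> f Wf; left.
  - by move=> /(_ s (or_intror erefl)) Ws; exact: (sR 0 s 0 Ws erefl).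
  - by move=> f [/Winj|->].
  - move=> f g m n [Wf|->] [Wg|->] //; first exact: Wdisj.
    + by move=> e; case: (sR n f m Wf).
    + by move=> /esym e; case: (sR m g n Wg).
have [f0 Wf0] : exists f, W f.
  apply: contrapT => W0; suff : infinite_set R by [].
  apply/infiniteP; have -> : R = setT; last by [].
  by apply/seteqP; split=> // t _ f n Wf; case: W0; exists f.
have [h hR] : exists h : nat -> T, R `<=` range h.
  have /pfcard_geP[->|[h]] := finite_set_countable finR.
    by exists f0 => x.
  by exists h; exact: 'surj_h.
pose S := {f | W f}.
pose dec (p : S * nat) : T := if odd p.2 then h p.2./2 else sval p.1 p.2./2.
have /choice[c cK] : forall t, exists p, dec p = t.
  move=> t; have [Rt|] := pselect (R t).
    have [n _ <-] := hR _ Rt; exists (exist _ f0 Wf0, n.*2.+1).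
    by rewrite /dec /= odd_double /= uphalf_double.
  move=> /existsNP[f] /existsNP[n] /not_implyP[Wf /contrapT <-].
  by exists (exist _ f Wf, n.*2); rewrite /dec /= odd_double doubleK.
apply: (@inj_cardT _ _
  (fun p : T * bool => sval (c p.1).1 ((c p.1).2.*2 + p.2))).
move=> [t b] [t' b'] /=; case: (c t) (cK t) => -[f Wf] n /= dt.
case: (c t') (cK t') => -[f' Wf'] n' /= dt' e.
have ff' := Wdisj _ _ _ _ Wf Wf' e; subst f'.
move/(Winj _ Wf) : e => e.
have eb : b = b'.
  by move/(congr1 odd): e; rewrite !oddD !odd_double !oddb.
subst b'; move/addIn/double_inj: e => en; subst n'.
by rewrite -dt -dt' /dec.
Qed.

Lemma card_ltU (T K : Type) (A B : set T) : [set: nat] #<= [set: K] ->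
  A #< [set: K] -> B #< [set: K] -> A `|` B #< [set: K].
Proof.
move=> Kinf; wlog AB : A B / A #<= B => [wlg|AK BK].
  have : A #<= B \/ B #<= A.
    have := card_le_totalT A B.
    by rewrite !(card_le_eql (card_setT _)) !(card_le_eqr (card_setT _)).
  by move=> [/wlg//|/wlg h AK BK]; rewrite setUC; exact: h.
apply/card_ltNle => KAB; have [fB|iB] := pselect (finite_set B).
  have fA : finite_set A := card_le_finite AB fB.
  have : infinite_set (A `|` B) by apply/infiniteP; exact: card_le_trans KAB.
  by apply; rewrite finite_setU.
apply: (card_ltNle _ _).1 BK _; apply: card_le_trans KAB _.
have /cardT_double : [set: nat] #<= [set: B].
  by rewrite (card_le_eqr (card_setT B)); exact/infiniteP.
rewrite (card_le_eqr (card_setT B)); apply: card_le_trans.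
have /cardT_inj[f fI] : [set: A] #<= [set: B].
  by rewrite (card_le_eql (card_setT A)) (card_le_eqr (card_setT B)).
rewrite -(card_le_eql (card_setT _)).
pose g (x : (A `|` B)%classic) : B * bool :=
  match pselect (B (val x)) with
  | left Bx => (SigSub (mem_set Bx), true)
  | right nBx => (f (SigSub (mem_set
      (match set_valP x with
       | or_introl a => a
       | or_intror b => False_ind _ (nBx b)
       end))), false)
  end.
apply: (@inj_cardT _ _ g) => x y; rewrite /g.
case: pselect => Bx; case: pselect => By // [].
  by move=> e; apply/val_inj.
by move=> /fI[] e; apply/val_inj.
Qed.

Definition succ_card (A : Type) : Type :=
  least_card (fun B => [set: A] #< [set: B]).

Definition small_cards (K : Type) : set (set K) :=
  [set L | L #< [set: K] /\ L = xget set0 [set M : set K | M #= L]].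
Arguments small_cards : clear implicits.

(* [A^{<K}], the sum of the powers [A^L] over the cardinals [L < K]; each such
   cardinal is the size of exactly one of the subsets in [small_cards K]. *)
Definition powlt (A K : Type) : Type := {L : small_cards K & val L -> A}.

Lemma small_cardsP (K : Type) (T : Type) (M : set T) : M #< [set: K] ->
  exists! L : set K, small_cards K L /\ M #= L.
Proof.
move=> MK; have /card_subP[C CM _] := (andP MK).1.
pose L := xget set0 [set N : set K | N #= C].
have LC : L #= C := @xgetI _ set0 [set N : set K | N #= C] C (card_eqxx C).
have LM : M #= L by apply/card_esym; apply: card_eq_trans LC CM.
have cls (N N' : set K) : N #= N' ->
    [set M : set K | M #= N] = [set M : set K | M #= N'].
  by move=> e; apply/seteqP; split=> D /= De;
    rewrite (card_eqr e) in De *.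
exists L; split.
  split=> //; split; last by rewrite (cls _ _ LC).
  by apply/card_ltNle; rewrite -(card_le_eqr LM); exact: (card_ltNle _ _).1 MK.
move=> L' [[_ eL'] ML']; rewrite eL' /L; congr (xget _ _).
by apply: cls; apply: card_eq_trans CM _.
Qed.

(* Only meaningful for an infinite [A]. *)
Definition cof (A : Type) : Type :=
  least_card (fun L => exists2 F : L -> set A,
    forall l, F l #< [set: A] & \bigcup_l F l = [set: A]).

Definition regular_card (A : Type) : Prop :=
  [set: nat] #<= [set: A] /\ [set: cof A] #= [set: A].

Definition strongly_inaccessible (K A : Type) : Prop :=
  [set: K] #< [set: A] /\
  forall B L : Type, [set: B] #< [set: A] -> [set: L] #< [set: K] ->
    [set: L -> B] #< [set: A].

Definition density (X : topologicalType) : Type :=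
  least_card (fun A => exists2 D : set X, dense D & D #= [set: A]).

Definition cellular (X : topologicalType) (F : set_system X) : Prop :=
  (forall U, F U -> open U /\ U !=set0) /\ trivIset F id.

Definition souslin (X : topologicalType) : Type :=
  least_card (fun A =>
    ~ exists2 F : set_system X, cellular F & F #= [set: A]).

Definition boxes (K I : Type) (X : I -> topologicalType) :
    set (set (forall i, X i)) :=
  [set B | exists U : forall i, set (X i), [/\ forall i, open (U i),
    [set i | U i <> setT] #< [set: K] & B = [set x | forall i, U i (x i)]]].
Arguments boxes K {I} X _.

(* [X_I] with the [K]-box topology; the boxes form a base because [K] is
   infinite. *)
Definition box_product (K : Type) (Kinf : [set: nat] #<= [set: K])
  (I : Type) (X : I -> topologicalType) : Type := forall i, X i.

Lemma boxes_cover (K I : Type) (X : I -> topologicalType) :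
  [set: nat] #<= [set: K] -> \bigcup_(B in boxes K X) B = setT.
Proof.
move=> Kinf; apply/seteqP; split=> // x _; exists setT => //.
exists (fun i => setT); split=> //; first by move=> i; exact: openT.
  rewrite (_ : [set i | _] = set0); last by apply/seteqP; split=> // i; apply.
  apply/card_ltNle => /(card_le_trans Kinf).
  by rewrite card_le0 => /eqP/seteqP[/(_ 0 Logic.I)].
by apply/seteqP; split.
Qed.

Lemma boxesI (K I : Type) (X : I -> topologicalType)
    (A B : set (forall i, X i)) : [set: nat] #<= [set: K] ->
  boxes K X A -> boxes K X B -> boxes K X (A `&` B).
Proof.
move=> Kinf [U [oU cU ->]] [V [oV cV ->]].
exists (fun i => U i `&` V i); split=> [i||].
- exact: openI.
- apply/card_ltNle => KUV; apply: (card_ltNle _ _).1 (card_ltU Kinf cU cV) _.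
  apply: card_le_trans KUV _; apply: subset_card_le => i /= UV.
  apply: contrapT => /not_orP[/contrapT Ui /contrapT Vi].
  by apply: UV; rewrite Ui Vi setIT.
- by apply/seteqP; split=> [x [h h'] i|x h]; split=> // i; case: (h i).
Qed.

Lemma boxes_join (K I : Type) (X : I -> topologicalType)
    (A B : set (forall i, X i)) (x : forall i, X i) :
    [set: nat] #<= [set: K] -> boxes K X A -> boxes K X B -> A x -> B x ->
  exists C, [/\ boxes K X C, C x & C `<=` A `&` B].
Proof.
by move=> Kinf bA bB Ax Bx; exists (A `&` B); split=> //; exact: boxesI.
Qed.

HB.instance Definition _ K Kinf I X :=
  gen_eqMixin (@box_product K Kinf I X).
HB.instance Definition _ K Kinf I X :=
  gen_choiceMixin (@box_product K Kinf I X).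
HB.instance Definition _ (K : Type) (Kinf : [set: nat] #<= [set: K])
    (I : Type) (X : I -> topologicalType) :=
  isBaseTopological.Build (box_product Kinf X)
    (boxes_cover X Kinf) (fun A B x => @boxes_join K I X A B x Kinf).

Lemma box_product_openE (K : Type) (Kinf : [set: nat] #<= [set: K])
    (I : Type) (X : I -> topologicalType) (A : set (box_product Kinf X)) :
  open A <-> forall x, A x -> exists B, [/\ boxes K X B, B x & B `<=` A].
Proof.
split=> [[D' D'b <-] x [B D'B Bx]|h].
  by exists B; split=> //; [exact: D'b|move=> y By; exists B].
exists [set B | boxes K X B /\ B `<=` A]; first by move=> B [].
apply/seteqP; split=> [x [B [_ BA] Bx]|x /h[B [bB Bx BA]]]; first exact: BA.
by exists B.
Qed.

Lemma cantor (T : Type) : ~ ([set: set T] #<= [set: T]).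
Proof.
move=> /cardT_inj[f fI]; pose D := [set y | exists Z, y = f Z /\ ~ Z y].
have nD : ~ D (f D) by move=> h; have [Z [/fI <-]] := h; apply.
by apply: (nD); exists D.
Qed.

Lemma succ_cardP (A : Type) : [set: A] #< [set: succ_card A] /\
  forall B : Type, [set: A] #< [set: B] -> [set: succ_card A] #<= [set: B].
Proof.
apply: least_cardP => [B C BC|].
  by move=> /card_ltNle h; apply/card_ltNle; rewrite -(card_le_eql BC).
by exists (set A); apply/card_ltNle; exact: cantor.
Qed.

Lemma cofP (A : Type) : [set: nat] #<= [set: A] ->
  (exists2 F : cof A -> set A,
     forall l, F l #< [set: A] & \bigcup_l F l = [set: A]) /\
  forall (L : Type) (F : L -> set A),
    (forall l, F l #< [set: A]) -> \bigcup_l F l = [set: A] ->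
    [set: cof A] #<= [set: L].
Proof.
move=> Ainf; have sets0 : @set0 A #< [set: A].
  apply/card_ltNle => /(card_le_trans Ainf).
  by rewrite card_le0 => /eqP/seteqP[/(_ 0 Logic.I)].
suff [cofA mincof] : (exists2 F : cof A -> set A,
     forall l, F l #< [set: A] & \bigcup_l F l = [set: A]) /\
  forall L : Type, (exists2 F : L -> set A,
     forall l, F l #< [set: A] & \bigcup_l F l = [set: A]) ->
    [set: cof A] #<= [set: L].
  by split=> // L F Flt FT; apply: mincof; exists F.
apply: least_cardP => [B C BC [F Flt FT]|].
  have /pfcard_geP[B0|[f]] : [set: B] #<= [set: C].
  - by rewrite (card_le_eql BC) card_lexx.
  - exists (fun=> set0) => //; rewrite -FT.
    apply/seteqP; split=> [a [c _ []]|a [b _ _]].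
    by have : [set: B] b by []; rewrite B0.
  - exists (F \o f) => [c|]; first exact: Flt.
    apply/seteqP; split=> // a _; have : [set: A] a by [].
    rewrite -FT => -[b _ Fb].
    have [c _ cb] : (f @` [set: C]) b by apply: 'surj_f.
    by exists c => //=; rewrite cb.
exists A, (fun a => [set a]) => [a|].
  apply/card_ltNle => /(card_le_trans Ainf) /infiniteP; apply.
  exact: finite_set1.
by apply/seteqP; split=> // a _; exists a.
Qed.

Lemma densityP (X : topologicalType) :
  (exists2 D : set X, dense D & D #= [set: density X]) /\
  forall D : set X, dense D -> [set: density X] #<= D.
Proof.
suff [dX minX] : (exists2 D : set X, dense D & D #= [set: density X]) /\
  forall A : Type, (exists2 D : set X, dense D & D #= [set: A]) ->
    [set: density X] #<= [set: A].
  split=> // D dD; rewrite -(card_le_eqr (card_setT D)); apply: minX.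
  by exists D => //; exact/card_esym/card_setT.
apply: least_cardP => [B C BC [D dD DB]|].
  by exists D => //; exact: card_eq_trans DB BC.
exists X, setT; last exact: card_eqxx.
by move=> O [x Ox] _; exists x.
Qed.

Lemma souslinP (X : topologicalType) :
  (~ exists2 F : set_system X, cellular F & F #= [set: souslin X]) /\
  forall A : Type, (~ exists2 F : set_system X, cellular F & F #= [set: A]) ->
    [set: souslin X] #<= [set: A].
Proof.
apply: least_cardP => [A B AB nA [F cF FB]|].
  by apply: nA; exists F => //; apply: card_eq_trans FB (card_esym AB).
exists (set (set X)) => -[F _ FX]; apply: (@cantor (set X)).
by rewrite -(card_le_eql FX); exact: card_leT.
Qed.

(* Main.v *)
From HB Require Import structures.
Require Import Defs.
From mathcomp Require Import all_boot.
From mathcomp Require Import all_classical topology_structure.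
From mathcomp Require Import wochoice.
From Stdlib Require Import Wellfounded Relation_Operators Eqdep_dec.

(* Write [mu] for [alpha^{<kappa}].  A cellular family refines to pairwise
   disjoint boxes with supports of size [< kappa].  For supports of a fixed size
   [lambda < kappa] a labelling of the boxes in the style of the
   Hewitt-Marczewski-Pondiczery theorem bounds their number by [alpha^lambda]
   (by [mu] if [lambda] is finite), so no cellular family is larger than [mu].

   If the four conditions hold, [alpha] boxes would contain, by a Delta-system
   argument, [alpha] boxes whose supports meet pairwise inside one set [J] of
   size [< kappa], and restricting these to [J] contradicts condition (iv).

   If one of them fails, a cellular family of size [mu] is built as a sum over
   the cardinals [lambda < kappa] (over [cof alpha] if [alpha = mu] is singular)
   of products of cellular families of the factors, each of size [< alpha]; only
   when [alpha = mu] is regular and larger than [kappa] does one need a product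
   [X_J] with [S(X_J) > alpha]. *)

Set Implicit Arguments.
Unset Strict Implicit.
Unset Printing Implicit Defensive.

Local Open Scope classical_set_scope.
Local Open Scope card_scope.

Local Notation "T ≲ U" := ([set: T] #<= [set: U]) (at level 70).
Local Notation "T ≺ U" := ([set: T] #< [set: U]) (at level 70).

(** * Cardinal arithmetic *)

Lemma card_lt_le T U (A : set T) (B : set U) : A #< B -> A #<= B.
Proof. by case/andP. Qed.

Lemma card_le_lt_trans T U V (A : set T) (B : set U) (C : set V) :
  A #<= B -> B #< C -> A #< C.
Proof.
by move=> AB /card_ltNle BC; apply/card_ltNle => CA; exact/BC/(card_le_trans CA).
Qed.

Lemma card_lt_le_trans T U V (A : set T) (B : set U) (C : set V) :
  A #< B -> B #<= C -> A #< C.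
Proof.
by move=> /card_ltNle AB BC; apply/card_ltNle => CA; exact/AB/(card_le_trans BC).
Qed.

Lemma card_lt_irr T (A : set T) : ~ (A #< A).
Proof. by move=> /card_ltNle; apply; exact: card_lexx. Qed.

Lemma card_NltP T U (A : set T) (B : set U) : ~ (A #< B) <-> B #<= A.
Proof.
split=> [h|BA /card_ltNle //]; apply: contrapT => h'; apply: h; exact/card_ltNle.
Qed.

Lemma card_set_ltE T U (A : set T) : ([set: A] #< [set: U]) = (A #< [set: U]).
Proof. by rewrite /card_lt (card_le_eql (card_setT A)) (card_eql (card_setT A)). Qed.

Lemma card_set_leE T U (A : set T) (B : set U) : ([set: A] #<= B) = (A #<= B).
Proof. by rewrite (card_le_eql (card_setT A)). Qed.

Lemma card_set_geE T U (A : set T) (B : set U) : (B #<= [set: A]) = (B #<= A).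
Proof. by rewrite (card_le_eqr (card_setT A)). Qed.

Lemma surj_cardT (T U : Type) (f : T -> U) : (forall u, exists t, f t = u) -> U ≲ T.
Proof.
move=> /choice[g gK]; apply: (@inj_cardT _ _ g) => x y e.
by rewrite -(gK x) -(gK y) e.
Qed.

Lemma cardT_surj (T U : Type) (u0 : U) : U ≲ T ->
  exists f : T -> U, forall u, exists t, f t = u.
Proof.
move=> /cardT_inj[g gI].
exists (fun t => if pselect (exists u, g u = t) is left h then projT1 (cid h) else u0).
move=> u; exists (g u); case: pselect => [h|[]]; last by exists u.
by case: (cid h) => v /= /gI.
Qed.

Lemma card_le_image_surj (T U : Type) (A : set T) (B : set U) (f : T -> U) :
  (forall b, B b -> exists2 a, A a & f a = b) -> B #<= A.
Proof.
move=> h; apply: card_le_trans (card_image_le f A).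
by apply: subset_card_le => b /h[a Aa <-]; exists a.
Qed.

Lemma card_le_injon (T U : Type) (A : set T) (B : set U) (f : T -> U) :
  (forall a, A a -> B (f a)) ->
  (forall a b, A a -> A b -> f a = f b -> a = b) -> A #<= B.
Proof.
move=> fAB fI; rewrite -card_set_leE -card_set_geE.
apply: (@inj_cardT _ _ (fun a : A => SigSub (mem_set (fAB _ (set_valP a))) : B)).
by move=> a b [] e; apply/val_inj/fI => //; exact: set_valP.
Qed.

Lemma prod_card_le T T' U U' : T ≲ T' -> U ≲ U' -> (T * U)%type ≲ (T' * U')%type.
Proof.
move=> /cardT_inj[f fI] /cardT_inj[g gI].
by apply: (@inj_cardT _ _ (fun p => (f p.1, g p.2))) => -[a b] [c d] [/= /fI-> /gI->].
Qed.

Lemma sum_card_le T T' U U' : T ≲ T' -> U ≲ U' -> (T + U)%type ≲ (T' + U')%type.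
Proof.
move=> /cardT_inj[f fI] /cardT_inj[g gI].
apply: (@inj_cardT _ _ (fun p => match p with inl a => inl (f a) | inr b => inr (g b) end)).
by move=> [a|b] [c|d] // [] => [/fI->|/gI->].
Qed.

Lemma fun_card_le L T U : T ≲ U -> (L -> T) ≲ (L -> U).
Proof.
move=> /cardT_inj[f fI]; apply: (@inj_cardT _ _ (fun h l => f (h l))) => g h e.
by apply/funext => l; apply: fI; exact: (congr1 (fun k => k l) e).
Qed.

Lemma fun_dom_card_le L M T (t0 : T) : L ≲ M -> (L -> T) ≲ (M -> T).
Proof.
move=> LM; have [[l0 _]|L0] := pselect (exists l : L, True).
  have [f fS] := cardT_surj l0 LM.
  apply: (@inj_cardT _ _ (fun h m => h (f m))) => g h e.
  by apply/funext => l; have [m <-] := fS l; exact: (congr1 (fun k => k m) e).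
apply: (@inj_cardT _ _ (fun=> fun=> t0)) => g h _.
by apply/funext => l; case: L0; exists l.
Qed.

Lemma set_card_le T U : T ≲ U -> set T ≲ set U.
Proof.
move=> /cardT_inj[f fI]; apply: (@inj_cardT _ _ (fun A => f @` A)) => A B e.
apply/seteqP; split=> x Ax.
  by have [y By /fI<-] : (f @` B) (f x) by rewrite -e; exists x.
by have [y By /fI<-] : (f @` A) (f x) by rewrite e; exists x.
Qed.

(** * Well-orders and the square of an infinite cardinal *)

Lemma card_lt_wf (T : Type) : well_founded (fun A B : set T => A #< B).
Proof.
move=> A; apply: contrapT => nA.
pose J := {B : set T | ~ Acc (fun A B : set T => A #< B) B}.
have [[B nB] minB] := @cardT_min J (fun j => projT1 j) (exist _ A nA).
apply: (nB); constructor => D DB; apply: contrapT => nD.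
apply: (card_ltNle _ _).1 DB _.
by rewrite -card_set_leE -card_set_geE; exact: (minB (exist _ D nD)).
Qed.

(* The order on [T] is only required to be well founded and trichotomous. *)
Definition wo_rel (T : Type) (R : T -> T -> Prop) :=
  well_founded R /\ forall x y, [\/ R x y, x = y | R y x].

Lemma wo_exists (T : Type) : exists R : T -> T -> Prop, wo_rel R.
Proof.
have [R Rwo] := @well_ordering_principle (HB.pack T (gen_eqMixin T)).
have Rmin (A : set T) : A !=set0 -> exists2 z, A z & forall x, A x -> R z x.
  move=> [a Aa]; pose P : {pred T} := fun x => `[< A x >].
  have [|z [[zP lz] _]] := Rwo P; first by exists a; exact/asboolP.
  by exists z => [|x Ax]; [exact/asboolP|apply: lz; exact/asboolP].
(* Antisymmetry comes from the uniqueness of the least element of the pair of [x] and [y]. *)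
have Rsub x y : R x y -> R y x -> x = y.
  move=> xy yx; have Rr z : R z z.
    by have [|w -> h] := Rmin [set z]; [exists z|exact: h].
  have [|z [_ zu]] := Rwo (fun t => `[< t = x \/ t = y >]).
    by exists x; apply/asboolP; left.
  rewrite -(zu x) ?(zu y) //; (split; first by apply/asboolP; auto);
    by move=> t /asboolP[]->.
exists (fun x y => R x y /\ x <> y); split.
  move=> x; apply: contrapT => nx.
  have [|z nz zP] := Rmin [set z | ~ Acc (fun x y => R x y /\ x <> y) z].
    by exists x.
  apply: nz; constructor => y [yz ne]; apply: contrapT => ny.
  by apply: ne; apply: Rsub => //; exact: zP.
move=> x y; have [->|ne] := pselect (x = y); first exact: Or32.
have [|z [->|->] zP] := Rmin [set x; y]; first by exists x; left.
  by apply: Or31; split=> //; apply: zP; right.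
by apply: Or33; split; [apply: zP; left|exact/nesym].
Qed.

(** By recursion along [R], each [t] is sent to a point of [M] not taken before; one is left because
    fewer than [M] elements precede [t]. *)
Lemma greedy_inj (T M : Type) (R : T -> T -> Prop) : wo_rel R ->
  (forall t, [set s | R s t] #< [set: M]) -> T ≲ M.
Proof.
move=> [Rwf Rtot] segM.
(* If [M] is empty, no segment is smaller than [M], so [T] is empty too. *)
have [[m0]|M0] := pselect (exists m : M, True); last first.
  apply: (@surj_cardT _ _ (fun m => match M0 (ex_intro _ m Logic.I) with end)).
  move=> t; have /card_ltNle[] := segM t.
  apply: (@card_le_injon _ _ _ _ (fun m => match M0 (ex_intro _ m Logic.I) with end)).
    by move=> m; case: M0; exists m.
  by move=> m; case: M0; exists m.
move=> _.
(* [pick] is arbitrary on the empty set, a value which the bound on the segments keeps out of the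
   recursion. *)
have /choice[pick pickP] : forall P : set M, exists m, (exists m', P m') -> P m.
  by move=> P; have [[m Pm]|nP] := pselect (exists m, P m); [exists m|exists m0].
pose step t (f : forall s, R s t -> M) := pick [set m | forall s h, f s h <> m].
pose g := Fix Rwf (fun=> M) step.
have gE t : g t = pick [set m | forall s, R s t -> g s <> m].
  rewrite /g Fix_eq // => x f f' ff'; congr pick.
  by apply/seteqP; split=> m h s hs; [rewrite -ff'|rewrite ff'].
have gN s t : R s t -> g s <> g t.
  move=> st; rewrite (gE t); apply: (pickP [set m | forall s, R s t -> g s <> m]) st.
  apply: contrapT => h; have /card_ltNle[] := segM t.
  apply: (@card_le_image_surj _ _ _ _ g) => m _; apply: contrapT => h'.
  by apply: h; exists m => s' s't e; apply: h'; exists s'.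
apply: (@inj_cardT _ _ g) => x y e.
by have [/gN|//|/gN/nesym] := Rtot x y.
Qed.

Lemma wo_rel_inj (S T : Type) (f : S -> T) (R : T -> T -> Prop) : injective f ->
  wo_rel R -> wo_rel (fun x y => R (f x) (f y)).
Proof.
move=> fI [Rwf Rtot]; split; first exact: wf_inverse_image.
by move=> x y; have [?|/fI->|?] := Rtot (f x) (f y); [exact: Or31|exact: Or32|exact: Or33].
Qed.

(** This is a well-order whose type is an initial ordinal. If some segment is as large as [T], take
    the first such segment and pull the order back along an injection of [T] into it. *)
Lemma initial_wo (T : Type) :
  exists2 R : T -> T -> Prop, wo_rel R & forall t, [set s | R s t] #< [set: T].
Proof.
have [R Rwo] := wo_exists T.
have [h|/existsNP[t0 /card_NltP ht0]] := pselect (forall t, [set s | R s t] #< [set: T]).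
  by exists R.
have [t [ht tmin]] : exists t, [set: T] #<= [set s | R s t] /\
    forall s, R s t -> [set u | R u s] #< [set: T].
  elim/(well_founded_ind Rwo.1): t0 ht0 => t IH ht.
  have [h|/existsNP[s /not_implyP[st /card_NltP]]] :=
    pselect (forall s, R s t -> [set u | R u s] #< [set: T]); first by exists t.
  exact: IH.
move: ht; rewrite -card_set_geE => /cardT_inj[f fI].
pose g x := val (f x); have gI : injective g by move=> x y /val_inj/fI.
have gt x : R (g x) t by exact: set_valP (f x).
exists (fun x y => R (g x) (g y)); first exact: wo_rel_inj.
move=> x; apply: card_le_lt_trans (tmin _ (gt x)).
by apply: (@card_le_injon _ _ _ _ g) => [//|a b _ _ /gI].
Qed.

(** By trichotomy a failure would close a cycle of length two or three, which well-foundedness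
    excludes. *)
Lemma wo_rel_trans (T : Type) (R : T -> T -> Prop) x y z :
  wo_rel R -> R x y -> R y z -> R x z.
Proof.
move=> [Rwf Rtot] xy yz; have [//|zx|zx] := Rtot x z.
all: exfalso; have cyc : forall w, w = x \/ w = y \/ w = z -> False;
  last exact: (cyc x (or_introl erefl)).
all: elim/(well_founded_ind Rwf) => w IH e.
  by subst z; case: e => [|[|]] e; subst w; [apply: (IH y)|apply: (IH x)|apply: (IH y)]; auto.
by case: e => [|[|]] e; subst w; [apply: (IH z)|apply: (IH x)|apply: (IH y)]; auto.
Qed.

Lemma finite_card_lt T (A : set T) K : finite_set A -> nat ≲ K -> A #< [set: K].
Proof.
move=> /finite_setPn fA Kinf; apply/card_ltNle => KA.
exact/fA/(card_le_trans Kinf).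
Qed.

Lemma finite_prodT T U : finite_set [set: T] -> finite_set [set: U] ->
  finite_set [set: T * U].
Proof. by rewrite -setXTT; exact: finite_setX. Qed.

(** Pairs are ordered by their maximum and then lexicographically. The pairs before [p] lie in the
    square of a proper closed segment, which is small by induction on the cardinal, so [greedy_inj]
    applies. *)
Lemma cardT_square (T : Type) : nat ≲ T -> (T * T)%type ≲ T.
Proof.
(* Subsets of one type are used because their cardinals are well founded by [card_lt_wf]. *)
suff h (A : set T) : nat ≲ A -> (A * A)%type ≲ A.
  have TA : T ≲ [set: T]%classic by rewrite card_set_geE card_lexx.
  move=> Tinf; apply: card_le_trans (prod_card_le TA TA) _.
  apply: card_le_trans (h _ (card_le_trans Tinf TA)) _.
  by rewrite card_set_leE card_lexx.
elim/(well_founded_ind (@card_lt_wf T)): A => A IH Ainf.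
have [R Rwo segT] := initial_wo A.
pose segle m := [set x | R x m] `|` [set m].
have segleT m : segle m #< [set: A].
  by apply: card_ltU => //; exact: finite_card_lt (finite_set1 _) Ainf.
pose mx (p : A * A) := if `[< R p.1 p.2 >] then p.2 else p.1.
have mx_ge p : segle (mx p) p.1 /\ segle (mx p) p.2.
  rewrite /mx; case: asboolP => h; first by split; [left|right].
  by split; [right|have [?|->|] := Rwo.2 p.1 p.2; [|right|left]].
have segle_trans m n x : segle m x -> segle n m -> segle n x.
  move=> [xm|->] // [mn|<-]; last by left.
  by left; exact: wo_rel_trans Rwo xm mn.
pose code (p : A * A) := (mx p, p).
have lex_wo (U V : Type) S Q : @wo_rel U S -> @wo_rel V Q -> wo_rel (slexprod U V S Q).
  move=> [Swf Stot] [Qwf Qtot]; split; first exact: wf_slexprod.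
  move=> [u v] [u' v'].
  have [?|<-|?] := Stot u u'; [by apply: Or31; left| |by apply: Or33; left].
  by have [?|->|?] := Qtot v v'; [apply: Or31; right|exact: Or32|apply: Or33; right].
have code_inj : injective code by move=> p q [].
have := wo_rel_inj code_inj (lex_wo _ _ _ _ Rwo (lex_wo _ _ _ _ Rwo Rwo)).
move/greedy_inj; apply=> p; set m := mx p.
have : (segle m * segle m)%type ≺ A.
  have sT : segle m ≺ A by rewrite card_set_ltE.
  (* The induction hypothesis is about subsets of [T], so the segment is moved there from [A]. *)
  pose B := val @` segle m.
  have Bs : segle m #= B by apply/card_esym/inj_card_eq => x y _ _ /val_inj.
  have [fs|/infiniteP si] := pselect (finite_set [set: segle m]).
    by apply: finite_card_lt => //; exact: finite_prodT.
  have sB : segle m ≲ B by rewrite card_set_leE card_set_geE (card_le_eql Bs) card_lexx.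
  have Bs' : B ≲ segle m by rewrite card_set_leE card_set_geE (card_le_eqr Bs) card_lexx.
  apply: card_le_lt_trans (card_le_trans (prod_card_le sB sB) _) sT.
  apply: card_le_trans Bs'; apply: IH; last exact: card_le_trans sB.
  apply: (@card_lt_le_trans _ _ _ _ [set: A]); last by rewrite card_set_leE card_lexx.
  by apply: card_le_lt_trans (segleT m); rewrite (card_le_eqr Bs) card_lexx.
apply: card_le_lt_trans.
have h (q : A * A) : slexprod A (A * A) R (slexprod A A R R) (code q) (code p) ->
    segle m q.1 /\ segle m q.2.
  move=> s; have mqm : segle m (mx q).
    by inversion s; [left|right].
  by have [q1 q2] := mx_ge q; split; apply: segle_trans mqm.
rewrite -card_set_leE.
apply: (@inj_cardT _ _ (fun q :
    [set s | slexprod A (A * A) R (slexprod A A R R) (code s) (code p)] =>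
  (SigSub (mem_set (h _ (set_valP q)).1) : segle m,
   SigSub (mem_set (h _ (set_valP q)).2) : segle m))).
move=> q q' [e1 e2]; apply/val_inj.
by rewrite (surjective_pairing (val q)) e1 e2 -surjective_pairing.
Qed.

(** * Products, sums, functions and cofinality *)

Lemma prod_card_inf M T U : nat ≲ M -> T ≲ M -> U ≲ M -> (T * U)%type ≲ M.
Proof.
by move=> Minf TM UM; apply: card_le_trans (prod_card_le TM UM) (cardT_square Minf).
Qed.

Lemma sum_card_inf M T U : nat ≲ M -> T ≲ M -> U ≲ M -> (T + U)%type ≲ M.
Proof.
move=> Minf TM UM; apply: card_le_trans (sum_card_le TM UM) _.
apply: card_le_trans (cardT_double Minf).
apply: (@inj_cardT _ _ (fun s => match s with inl a => (a, true) | inr a => (a, false) end)).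
by move=> [a|a] [b|b] // [->].
Qed.

Lemma prod_card_lt K T U : nat ≲ K -> T ≺ K -> U ≺ K -> (T * U)%type ≺ K.
Proof.
move=> Kinf; wlog TU : T U / T ≲ U => [wlg|TK UK].
  have [/wlg//|/wlg h TK UK] := card_le_totalT T U.
  apply: card_le_lt_trans (h UK TK).
  by apply: (@inj_cardT _ _ (fun p => (p.2, p.1))) => -[a b] [c d] [-> ->].
have [fU|/infiniteP Ui] := pselect (finite_set [set: U]).
  by apply: finite_card_lt => //; apply: finite_prodT => //; exact: card_le_finite TU fU.
by apply: card_le_lt_trans UK; apply: prod_card_inf => //; exact: card_lexx.
Qed.

Lemma curry_card L M T : (L -> M -> T) ≲ (L * M -> T).
Proof.
apply: (@inj_cardT _ _ (fun h p => h p.1 p.2)) => g h e.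
by apply/funext => l; apply/funext => m; exact: (congr1 (fun k => k (l, m)) e).
Qed.

Lemma existT_injective (A : Type) (P : A -> Type) (a : A) : injective (existT P a).
Proof. by move=> x y; apply: inj_pair2_eq_dec => b c; exact: pselect. Qed.

Lemma card_le_sigT (A : Type) (P : A -> Type) (a : A) : P a ≲ {x : A & P x}.
Proof. exact: inj_cardT (@existT_injective A P a). Qed.

Lemma sigT_card_le (A : Type) (P Q : A -> Type) :
  (forall a, P a ≲ Q a) -> {a : A & P a} ≲ {a : A & Q a}.
Proof.
move=> PQ; have /all_sig[f fI] : forall a, {f : P a -> Q a | injective f}.
  by move=> a; exact/cid/cardT_inj.
apply: (@inj_cardT _ _ (fun p => existT Q (projT1 p) (f _ (projT2 p)))).
move=> [a x] [b y] /= e; have ab : a = b := congr1 (@projT1 _ _) e.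
by subst b; rewrite (fI a _ _ (@existT_injective _ _ _ _ _ e)).
Qed.

Lemma sigT_card_prod (A : Type) (P : A -> Type) (M : Type) :
  (forall a, P a ≲ M) -> {a : A & P a} ≲ (A * M)%type.
Proof.
move=> PM; apply: card_le_trans (@sigT_card_le _ _ (fun=> M) PM) _.
apply: (@inj_cardT _ _ (fun p : {a : A & M} => (projT1 p, projT2 p))).
by move=> [a x] [b y] /= [-> ->].
Qed.

Lemma sigT_card_inf (A : Type) (P : A -> Type) (M : Type) : nat ≲ M -> A ≲ M ->
  (forall a, P a ≲ M) -> {a : A & P a} ≲ M.
Proof.
move=> Minf AM PM; apply: card_le_trans (sigT_card_prod PM) _.
by apply: prod_card_inf => //; exact: card_lexx.
Qed.

Lemma option_card_lt (T A : Type) : nat ≲ A -> T ≺ A -> option T ≺ A.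
Proof.
move=> Ainf TA; apply: (@card_le_lt_trans _ _ _ _ (some @` [set: T] `|` [set None])).
  by apply: subset_card_le => -[x|] _; [left; exists x|right].
apply: card_ltU => //; last exact: finite_card_lt (finite_set1 _) Ainf.
by apply: card_le_lt_trans (card_image_le _ _) _.
Qed.

Lemma unit_fun_card_le (T : Type) : T ≲ (unit -> T).
Proof. by apply: (@inj_cardT _ _ (fun a _ => a)) => a b /(congr1 (fun h => h tt)). Qed.

Lemma exp_card_le (T A : Type) : bool ≲ A -> T ≲ (T -> A).
Proof.
move=> A2; apply: card_le_trans (fun_card_le _ A2).
apply: (@inj_cardT _ _ (fun x y => `[< x = y >])) => x y /(congr1 (fun f => f y)).
by rewrite [RHS]asboolT // => /asboolP.
Qed.

Lemma cof_card_le (A : Type) : nat ≲ A -> cof A ≲ A.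
Proof.
move=> Ainf; apply: ((cofP Ainf).2 _ (fun a => [set a])) => [a|].
  exact: finite_card_lt (finite_set1 a) Ainf.
by apply/seteqP; split=> // a _; exists a.
Qed.

(** If the union contained a copy of [A], the traces of the sets [F l] on this copy would cover [A]
    by fewer than [cof A] small sets. *)
Lemma bigcup_lt_cof (A L T : Type) (F : L -> set T) : nat ≲ A -> L ≺ cof A ->
  (forall l, F l #< [set: A]) -> \bigcup_l F l #< [set: A].
Proof.
move=> Ainf Lcof Flt; apply/card_ltNle; rewrite -card_set_geE => /cardT_inj[f fI].
apply: (card_ltNle _ _).1 Lcof _.
apply: ((cofP Ainf).2 _ (fun l => [set a | F l (val (f a))])) => [l|].
  apply: card_le_lt_trans (Flt l); apply: (@card_le_injon _ _ _ _ (fun a => val (f a))) => //.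
  by move=> a b _ _ /val_inj/fI.
apply/seteqP; split=> // a _; have [l _ Fl] := set_valP (f a).
by exists l.
Qed.

(* Below the cofinality functions into [A] are bounded, for a well-order of [A]
   with small initial segments. *)
Lemma fun_card_lt_cof (A L : Type) : nat ≲ A -> L ≺ cof A ->
  (forall B, B ≺ A -> (L -> B) ≲ A) -> (L -> A) ≲ A.
Proof.
move=> Ainf Lcof pow; have [R Rwo segA] := initial_wo A.
have bnd (h : L -> A) : exists w, forall l, R (h l) w.
  apply: contrapT => nb; pose F l := [set x | R x (h l)] `|` [set h l].
  have Flt l : F l #< [set: A].
    by apply: card_ltU => //; exact: finite_card_lt (finite_set1 _) Ainf.
  have /card_ltNle := bigcup_lt_cof Ainf Lcof Flt; apply; apply: subset_card_le => w _.
  apply: contrapT => nw; apply: nb; exists w => l.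
  have [//|e|wh] := Rwo.2 (h l) w; case: nw; exists l => //; first by right.
  by left.
have /all_sig[b bP] : forall h : L -> A, {w | forall l, R (h l) w}
    by move=> h; exact: cid (bnd h).
apply: (@card_le_trans _ _ _ [set: {w : A & L -> [set x | R x w]}]).
  apply: (@inj_cardT _ _ (fun h => existT (fun w => L -> [set x | R x w]) (b h)
    (fun l => SigSub (mem_set (bP h l))))) => g h e.
  by have := congr1 (fun p : {w : A & L -> [set x | R x w]} => (fun l => val (projT2 p l))) e.
apply: sigT_card_inf => // w; apply: pow; rewrite card_set_ltE; exact: segA.
Qed.

(** * The power [alpha^{<kappa}] *)

Lemma small_cards_lt K (L : small_cards K) : val L #< [set: K].
Proof. by have [] := set_valP L. Qed.

Lemma small_cards_ex K T (M : set T) : M #< [set: K] ->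
  exists L : small_cards K, M #= val L.
Proof.
move=> /small_cardsP[L [[Lsc ML] _]].
by exists (SigSub (mem_set Lsc)).
Qed.

Lemma small_cards_inj K (L M : small_cards K) : val L #= val M -> L = M.
Proof.
move=> LM; have [N [_ uN]] := small_cardsP (small_cards_lt L).
apply/val_inj; rewrite -(uN (val L)) ?(uN (val M)) //; split=> //.
- exact: set_valP.
- exact: set_valP.
Qed.

Definition small_card_lt K (L M : small_cards K) := val L #< val M.

Lemma small_cards_wo K : wo_rel (@small_card_lt K).
Proof.
split; first exact: wf_inverse_image (@card_lt_wf K).
move=> L M; have [?|/card_NltP ML] := pselect (val L #< val M); first exact: Or31.
have [?|/card_NltP LM] := pselect (val M #< val L); first exact: Or33.
by apply: Or32; apply: small_cards_inj; rewrite card_eq_le LM.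
Qed.

(** By induction, each [M] below [L] has at most [val M], hence fewer than [val L], predecessors; so
    the segment embeds greedily into [val L]. *)
Lemma small_cards_seg K (L : small_cards K) :
  [set M | small_card_lt M L] #<= val L.
Proof.
elim/(well_founded_ind (small_cards_wo K).1): L => L IH.
rewrite -card_set_leE -card_set_geE.
have := wo_rel_inj (@val_inj _ _ [set M | small_card_lt M L]) (small_cards_wo K).
move/greedy_inj; apply=> M.
have ML : small_card_lt (val M) L := set_valP M.
apply: (@card_lt_le_trans _ _ _ _ (val L)); last by rewrite card_set_geE card_lexx.
apply: card_le_lt_trans (ML); apply: card_le_trans (IH _ ML).
by apply: (@card_le_injon _ _ _ _ val) => // a b _ _ /val_inj.
Qed.

Lemma small_cards_le K : small_cards K ≲ K.
Proof.
apply: (greedy_inj (small_cards_wo K)) => L.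
exact: card_le_lt_trans (small_cards_seg L) (small_cards_lt L).
Qed.

Lemma lt_succ_card T (A : set T) I : A #< [set: succ_card I] -> A #<= [set: I].
Proof.
move=> AI; apply: contrapT => /card_ltNle IA.
have : [set: succ_card I] #<= A.
  rewrite -card_set_geE; apply: (succ_cardP I).2.
  by apply: card_lt_le_trans IA _; rewrite card_set_geE card_lexx.
by move/(card_ltNle _ _).1 : AI.
Qed.

(** Every cardinal in [small_cards K] is at most that of [I]. If some [L] has at least [I]
    predecessors, then nothing lies above [L], and there are at most [val L] cardinals besides
    [L]. *)
Lemma small_cards_le_succ K I : nat ≲ I -> K ≲ succ_card I -> small_cards K ≲ I.
Proof.
move=> Iinf KI.
have leI (L : small_cards K) : val L #<= [set: I].
  exact/lt_succ_card/(card_lt_le_trans (small_cards_lt L)).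
have [h|/existsNP[L /card_NltP IL]] :=
    pselect (forall L : small_cards K, [set M | small_card_lt M L] #< [set: I]).
  exact: (greedy_inj (small_cards_wo K)).
have LM (M : small_cards K) : small_card_lt M L \/ M = L.
  have [|->|] := (small_cards_wo K).2 M L; [by left|by right|].
  move=> LM; case: (@card_lt_irr _ [set: I]).
  apply: card_le_lt_trans (card_le_trans IL (small_cards_seg L)) _.
  exact: card_lt_le_trans LM (leI M).
apply: (@card_le_trans _ _ _ [set: val L + unit]).
  have : [set: [set M | small_card_lt M L]] #<= val L.
    by rewrite card_set_leE; exact: small_cards_seg.
  rewrite -card_set_geE => /cardT_inj[f fI].
  apply: (@inj_cardT _ _ (fun M => match pselect (small_card_lt M L) with
    | left h => inl (f (SigSub (@mem_set _ [set N | small_card_lt N L] M h)))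
    | right _ => inr tt end)).
  move=> M N; case: pselect => hM; case: pselect => hN //.
    by move=> [/fI[]].
  by move=> _; have [//|->] := LM M; have [//|->] := LM N.
apply: sum_card_inf => //; first by rewrite card_set_leE.
by apply: card_le_trans Iinf; apply: (@inj_cardT _ _ (fun=> 0)) => -[] [].
Qed.

(** For [I] with at most [n] elements the successor is at most [2^n], which is finite. *)
Lemma infinite_of_succ I : nat ≲ succ_card I -> nat ≲ I.
Proof.
move=> sinf; apply/infiniteP => /finite_set_leP[n].
rewrite (card_le_eqr card_II) => In.
have : succ_card I ≲ set 'I_n.
  apply: (succ_cardP I).2; apply: card_lt_le_trans (set_card_le In).
  by apply/card_ltNle; exact: cantor.
move=> /(card_le_trans sinf) h.
have : nat ≲ {ffun 'I_n -> bool}.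
  apply: card_le_trans h _.
  apply: (@inj_cardT _ _ (fun A => [ffun i => `[< A i >]])) => A B e.
  apply/seteqP; split=> i.
    by move/asboolP; move/ffunP/(_ i): e; rewrite !ffunE => -> /asboolP.
  by move/asboolP; move/ffunP/(_ i): e; rewrite !ffunE => <- /asboolP.
move/infiniteP; apply; exact: finite_finset.
Qed.

Lemma powlt_ge_small (A K : Type) (L : small_cards K) : (val L -> A) ≲ powlt A K.
Proof. exact: (@card_le_sigT _ (fun L : small_cards K => val L -> A)). Qed.

Lemma powlt_ge (A K T : Type) (a0 : A) : T ≺ K -> (T -> A) ≲ powlt A K.
Proof.
move=> /small_cards_ex[L TL]; apply: card_le_trans (powlt_ge_small A L).
apply: fun_dom_card_le => //; rewrite card_set_geE.
by rewrite (card_le_eql TL) card_lexx.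
Qed.

(** Otherwise the cardinal of [powlt A K] is itself one of the exponents, and [powlt A K] is at
    least its own power set. *)
Lemma powlt_ge_exp (A K : Type) : bool ≲ A -> K ≲ powlt A K.
Proof.
move=> A2; apply/card_NltP => /small_cards_ex[L eL].
apply: (@cantor (powlt A K)); apply: card_le_trans (powlt_ge_small A L).
apply: (@card_le_trans _ _ _ [set: val L -> bool]); last exact: fun_card_le.
apply: (@card_le_trans _ _ _ [set: set (val L)]).
  by apply: set_card_le; rewrite card_set_geE (card_le_eql eL) card_lexx.
apply: (@inj_cardT _ _ (fun B l => `[< B l >])) => B C e.
apply/seteqP; split=> l Xl; apply/asboolP.
  by rewrite -(congr1 (fun f => f l) e); exact/asboolP.
by rewrite (congr1 (fun f => f l) e); exact/asboolP.
Qed.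

Lemma powlt_le (A K M : Type) : nat ≲ M -> K ≲ M ->
  (forall L : small_cards K, (val L -> A) ≲ M) -> powlt A K ≲ M.
Proof.
move=> Minf KM; apply: sigT_card_inf => //.
exact: card_le_trans (small_cards_le K) KM.
Qed.

(** * Cellular families in box products *)

(** A cellular family indexed by [A]; as the members are nonempty, the last clause makes the
    indexing injective. *)
Definition has_cell (A : Type) (X : topologicalType) := exists U : A -> set X,
  [/\ forall a, open (U a), forall a, U a !=set0 &
      forall a b, U a `&` U b !=set0 -> a = b].

Lemma has_cell_le (A B : Type) (X : topologicalType) :
  B ≲ A -> has_cell A X -> has_cell B X.
Proof.
move=> /cardT_inj[f fI] [U [oU U0 Ud]]; exists (U \o f); split=> [b|b|b c /Ud/fI] //=.
Qed.

Lemma has_cellP (A : Type) (X : topologicalType) :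
  has_cell A X <-> exists2 F : set_system X, cellular F & F #= [set: A].
Proof.
split=> [[U [oU U0 Ud]]|[F [Fo Fd] FA]].
  exists (range U).
    split; first by move=> _ [a _ <-].
    by move=> _ _ [a _ <-] [b _ <-] /= /Ud->.
  apply: inj_card_eq => a b _ _ e; apply: Ud.
  by rewrite e setIid.
have : A ≲ F by rewrite card_set_geE (card_le_eqr FA) card_lexx.
move=> /cardT_inj[f fI]; exists (fun a => val (f a)).
have fF a : F (val (f a)) := set_valP (f a).
split=> [a|a|a b /(Fd _ _ (fF a) (fF b))/val_inj/fI//].
  exact: (Fo _ (fF a)).1.
exact: (Fo _ (fF a)).2.
Qed.

(** Cellular families can be thinned out, so the sizes that occur are exactly those below the least
    size that does not. *)
Lemma lt_souslin (A : Type) (X : topologicalType) : A ≺ souslin X <-> has_cell A X.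
Proof.
have [nS minS] := souslinP X; split.
  by move=> /card_ltNle h; apply: contrapT => /has_cellP nA; exact/h/minS.
move=> cA; apply/card_ltNle => SA; apply/nS/has_cellP; exact: has_cell_le cA.
Qed.

(** Cellular families of boxes, given by their sides: two boxes meet as soon as their sides meet in
    every coordinate. *)
Definition has_boxes (K I : Type) (X : I -> topologicalType) (G : Type) :=
  exists V : G -> forall i, set (X i),
  [/\ forall g i, open (V g i), forall g i, V g i !=set0,
      forall g, [set i | V g i <> setT] #< [set: K] &
      forall g h, (forall i, V g i `&` V h i !=set0) -> g = h].
Arguments has_boxes K {I} X G.

(** A nonempty open set contains a nonempty box, so shrinking every member of a cellular family
    leaves boxes. *)
Lemma has_boxesP (K : Type) (Kinf : nat ≲ K) I (X : I -> topologicalType) G :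
  has_cell G (box_product Kinf X) <-> has_boxes K X G.
Proof.
split=> [[U [oU U0 Ud]]|[V [oV V0 sV Vd]]].
  have /choice[V VP] : forall g, exists V : forall i, set (X i),
      [/\ forall i, open (V i), forall i, V i !=set0,
      [set i | V i <> setT] #< [set: K] &
      [set x | forall i, V i (x i)] `<=` U g].
    move=> g; have [x Ux] := U0 g.
    have [B [[V [oV sV ->]] Vx BU]] := (box_product_openE _).1 (oU g) x Ux.
    by exists V; split=> // i; exists (x i).
  exists V; split=> [g|g|g|g h gh]; try by have [] := VP g.
  have [_ _ _ gU] := VP g; have [_ _ _ hU] := VP h.
  have /all_sig[z zP] : forall i, {z | (V g i `&` V h i) z}.
    by move=> i; exact: cid (gh i).
  by apply: Ud; exists z; split; [apply: gU|apply: hU] => i; have [] := zP i.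
exists (fun g => [set x : box_product Kinf X | forall i, V g i (x i)]); split=> [g|g|g h].
- apply/box_product_openE => x Vx; exists [set x | forall i, V g i (x i)].
  by split=> //; exists (V g).
- have /all_sig[z zP] : forall i, {z | V g i z} by move=> i; exact: cid (V0 g i).
  by exists z.
- by move=> [x [gx hx]]; apply: Vd => i; exists (x i).
Qed.

Lemma has_boxes_le K I (X : I -> topologicalType) G H : H ≲ G ->
  has_boxes K X G -> has_boxes K X H.
Proof.
move=> /cardT_inj[f fI] [V [oV V0 sV Vd]].
by exists (V \o f); split=> [g|g|g|g h /Vd/fI] //=.
Qed.

Lemma has_boxes_factor K I (X : I -> topologicalType) (A : Type) (i0 : I) :
  nat ≲ K -> (forall i, has_cell A (X i)) -> has_boxes K X A.
Proof.
move=> Kinf /(_ _)/cid-/all_sig[U UP].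
exists (fun a i => if `[< i = i0 >] then U i a else setT); split=> [a i|a i|a|a b].
- by have [oU _ _] := UP i; case: ifP => // _; exact: openT.
- have [_ U0 _] := UP i; case: ifP => // _.
  by have [x _] := U0 a; exists x.
- apply: finite_card_lt => //; apply: sub_finite_set (finite_set1 i0) => i /=.
  by case: asboolP.
- by move=> /(_ i0); case: asboolP => // _; have [_ _ Ud] := UP i0; apply: Ud.
Qed.

(** Coordinate [i0] encodes [a], and coordinate [i1] then separates the elements of [B a]. *)
Lemma has_boxes_factor2 K I (X : I -> topologicalType) (A : Type) (B : A -> Type)
    (i0 i1 : I) : nat ≲ K -> i1 <> i0 -> (forall i, has_cell A (X i)) ->
    (forall i a, has_cell (B a) (X i)) ->
  has_boxes K X {a : A & B a}.
Proof.
move=> Kinf i10 /(_ _)/cid-/all_sig[U UP].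
move=> /(_ _ _)/cid-/(_ _)/all_sig-/all_sig[W WP].
exists (fun (p : {a : A & B a}) i => if `[< i = i0 >] then U i (projT1 p) else
  if `[< i = i1 >] then W (projT1 p) i (projT2 p) else setT).
split=> [[a b] i|[a b] i|[a b]|[a b] [c d]] /=.
- have [oU _ _] := UP i; have [oW _ _] := WP a i.
  by case: ifP => // _; case: ifP => // _; exact: openT.
- have [_ U0 _] := UP i; have [_ W0 _] := WP a i; have [x _] := U0 a.
  by case: ifP => // _; case: ifP => // _; exists x.
- apply: finite_card_lt => //; apply: sub_finite_set (finite_set2 i0 i1) => i /=.
  by case: asboolP; [left|case: asboolP; [right|]].
- move=> h; have ac : a = c.
    by have := h i0; case: asboolP => // _; have [_ _ Ud] := UP i0; apply: Ud.
  subst c; congr existT; have := h i1.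
  by do 2 case: asboolP => //; move=> _ _; have [_ _ Wd] := WP a i1; apply: Wd.
Qed.

Lemma has_boxes_extend K I (X : I -> topologicalType) (J : set I) G :
  (forall i, [set: X i] !=set0) ->
  has_boxes K (fun j : J => X (val j)) G -> has_boxes K X G.
Proof.
move=> X0 [V [oV V0 sV Vd]].
exists (fun g i => match pselect (J i) with
  | left h => V g (SigSub (mem_set h)) | right _ => setT end).
split=> [g i|g i|g|g h gh].
- by case: pselect => h; [exact: oV|exact: openT].
- by case: pselect => h; [exact: (V0 g (SigSub (mem_set h) : J))|exact: X0].
- apply: card_le_lt_trans (sV g).
  apply: (@card_le_image_surj _ _ _ _ (fun j : J => val j)) => i /=.
  case: pselect => // h Vi.
  by exists (SigSub (mem_set h)).
- apply: Vd => -[i iJ]; have := gh i; case: pselect => [h'|]; last by case; exact: set_mem.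
  by rewrite (bool_irrelevance (mem_set h') iJ).
Qed.

(** At a coordinate outside [J] one of two distinct boxes has full side, so the boxes meet there and
    must be separated inside [J]. *)
Lemma has_boxes_restrict K I (X : I -> topologicalType) (J : set I) G
    (V : G -> forall i, set (X i)) :
  (forall g i, open (V g i)) -> (forall g i, V g i !=set0) ->
  (forall g, [set i | V g i <> setT] #< [set: K]) ->
  (forall g h, (forall i, V g i `&` V h i !=set0) -> g = h) ->
  (forall g h, g <> h -> [set i | V g i <> setT /\ V h i <> setT] `<=` J) ->
  has_boxes K (fun j : J => X (val j)) G.
Proof.
move=> oV V0 sV Vd VJ; exists (fun g j => V g (val j)); split=> // [g|g h gh].
  apply: card_le_lt_trans (sV g).
  by apply: (@card_le_injon _ _ _ _ val) => // a b _ _ /val_inj.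
have [//|ne] := pselect (g = h); apply: Vd => i.
have [Ji|nJ] := pselect (J i); first exact: gh (SigSub (mem_set Ji)).
have [->|Vg] := pselect (V g i = setT); first by rewrite setTI.
have [->|Vh] := pselect (V h i = setT); first by rewrite setIT.
by case: nJ; exact: (VJ g h ne).
Qed.

Lemma injective_pinv T U (f : T -> U) : injective f ->
  exists g : U -> option T, (forall x, g (f x) = Some x) /\
    forall y x, g y = Some x -> f x = y.
Proof.
move=> fI; exists (fun y => if pselect (exists x, f x = y) is left h
  then Some (projT1 (cid h)) else None); split=> [x|y x].
  case: pselect => [h|[]]; last by exists x.
  by case: cid => z /= /fI->.
by case: pselect => // h; case: cid => z /= <- [->].
Qed.

(* The coordinates in a copy of [small_cards K] carry the prefix code
   [0, ..., 0, 1] which tells the summands apart. *)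
Lemma has_boxes_sum K I (X : I -> topologicalType) (Z : small_cards K -> Type)
    (B : forall L, Z L -> Type) : nat ≲ K -> K ≲ succ_card I ->
    (forall i, has_cell bool (X i)) -> (forall L, Z L ≺ K) ->
    (forall i L (z : Z L), has_cell (B L z) (X i)) ->
  has_boxes K X {L : small_cards K & forall z : Z L, B L z}.
Proof.
move=> Kinf KI cell2 ZK cellB.
have Iinf : nat ≲ I by apply: infinite_of_succ; exact: card_le_trans KI.
(* The left summand provides the coordinates of the prefix codes, the right one a copy of [I] in
   which [e L] places the factors of the product for [L]. *)
have /cardT_inj[c cI] : (small_cards K + I)%type ≲ I.
  by apply: sum_card_inf => //; exact: small_cards_le_succ.
have /all_sig[e eI] : forall L, {e : Z L -> I | injective e}.
  by move=> L; exact/cid/cardT_inj/lt_succ_card/(card_lt_le_trans (ZK L)).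
have [D [DK DE]] := injective_pinv cI.
have /all_sig[E EP] : forall L, {E : I -> option (Z L) |
    (forall x, E (e L x) = Some x) /\ forall y x, E y = Some x -> e L x = y}.
  by move=> L; exact/cid/injective_pinv/eI.
have /all_sig[U UP] := fun i => cid (cell2 i).
have /all_sig[W WP] : forall p : {i : I & {L : small_cards K & Z L}},
  {W : B _ (projT2 (projT2 p)) -> set (X (projT1 p)) |
    [/\ forall a, open (W a), forall a, W a !=set0 &
      forall a b, W a `&` W b !=set0 -> a = b]}.
  by move=> [i [L z]] /=; exact: cid (cellB i L z).
pose w i L z := W (existT _ i (existT _ L z)).
have wP i L z : [/\ forall a, open (w i L z a), forall a, w i L z a !=set0 &
      forall a b, w i L z a `&` w i L z b !=set0 -> a = b].
  exact: (WP (existT _ i (existT _ L z))).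
have X0 i : [set: X i] !=set0 by have [_ h _] := UP i; have [x _] := h true; exists x.
pose V (p : {L : small_cards K & forall z : Z L, B L z}) (i : I) : set (X i) :=
  match D i with
  | Some (inl M) => if `[< small_card_lt M (projT1 p) >] then U i false
                    else if `[< M = projT1 p >] then U i true else setT
  | Some (inr k) => if E (projT1 p) k is Some z then w i (projT1 p) z (projT2 p z) else setT
  | None => setT
  end.
exists V; split=> [[L h] i|[L h] i|[L h]|[L h] [L' h'] LL'].
- rewrite /V /=; have [oU _ _] := UP i; case: (D i) => [[M|k]|]; last exact: openT.
    by case: ifP => // _; case: ifP => // _; exact: openT.
  by case: (E L k) => [z|]; [have [oW _ _] := wP i L z|exact: openT].
- rewrite /V /=; have [_ U0 _] := UP i; case: (D i) => [[M|k]|]; last exact: X0.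
    by case: ifP => // _; case: ifP => // _.
  by case: (E L k) => [z|//]; have [_ W0 _] := wP i L z.
(* The support lies in the code coordinates of [L] and of the cardinals below it, together with the
   coordinates given by [e L]; each part is smaller than [K]. *)
- apply: (@card_le_lt_trans _ _ _ _ (((c \o inl) @` ([set M | small_card_lt M L] `|` [set L]))
    `|` ((c \o inr \o e L) @` [set: Z L]))).
    apply: subset_card_le => i; rewrite /V /=; case Di: (D i) => [[M|k]|//].
      case: asboolP => [ML _|_]; first by left; exists M; [left|exact: DE].
      by case: asboolP => [ML _|//]; left; exists M; [right|exact: DE].
    case Ek: (E L k) => [z|//] _; right; exists z => //=.
    by rewrite ((EP L).2 _ _ Ek); exact: DE.
  apply: card_ltU => //; last exact: card_le_lt_trans (card_image_le _ _) (ZK L).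
  apply: card_le_lt_trans (card_image_le _ _) _; apply: card_ltU => //.
    exact: card_le_lt_trans (small_cards_seg L) (small_cards_lt L).
  exact: finite_card_lt (finite_set1 L) Kinf.
(* At the code coordinate of [M], the box for [M] has side [U true] and the box for the larger [N]
   has side [U false]. *)
have nlt M N (g : forall z, B M z) (g' : forall z, B N z) : small_card_lt M N ->
    ~ forall i, V (existT _ M g) i `&` V (existT _ N g') i !=set0.
  move=> MN /(_ (c (inl M))); rewrite /V DK /=.
  case: asboolP => [MM|_]; first by case: (@card_lt_irr _ (val M)).
  case: asboolP => // _; case: asboolP => // _.
  by have [_ _ Ud] := UP (c (inl M)); move=> /Ud.
have [LM|e0|LM] := (small_cards_wo K).2 L L'.
- by case: (nlt _ _ h h' LM).
- subst L'; congr existT; apply: functional_extensionality_dep => z.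
  have := LL' (c (inr (e L z))); rewrite /V DK /= (EP L).1.
  by have [_ _ Wd] := wP (c (inr (e L z))) L z; apply: Wd.
- case: (nlt _ _ h' h LM) => i; rewrite setIC; exact: LL'.
Qed.

(** * The upper bound for cellular families *)

Lemma finite_fun_card_le L M : finite_set [set: L] -> nat ≲ M -> (L -> M) ≲ M.
Proof.
move=> /finite_set_leP[n]; rewrite (card_le_eqr card_II) => Ln Minf.
have /cardT_inj[s _] := Minf.
apply: card_le_trans (fun_dom_card_le (s 0) Ln) _.
elim: n {Ln} => [|n IH].
  by apply: (@inj_cardT _ _ (fun=> s 0)) => f g _; apply/funext => -[].
apply: card_le_trans (prod_card_inf Minf (card_lexx [set: M]) IH).
apply: (@inj_cardT _ _ (fun f => (f ord0, f \o lift ord0))) => f g [e0 e].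
apply/funext => i; case: (unliftP ord0 i) => [j ->|->//].
by have := congr1 (fun h => h j) e.
Qed.

Lemma card_le_funon T U (A : set T) (u0 : U) : A #<= [set: U] ->
  exists f : T -> U, forall x y, A x -> A y -> f x = f y -> x = y.
Proof.
rewrite -card_set_leE => /cardT_inj[f fI].
exists (fun x => if pselect (A x) is left h then f (SigSub (mem_set h)) else u0).
move=> x y Ax Ay; case: pselect => [hx|//]; case: pselect => [hy|//].
by move=> /fI[].
Qed.

Lemma card_le_cover T U (A : set T) (t0 : T) : A #<= [set: U] ->
  exists f : U -> T, forall x, A x -> exists u, f u = x.
Proof.
rewrite -card_set_leE => /cardT_inj[f /injective_pinv[g [gK _]]].
exists (fun u => if g u is Some x then val x else t0) => x Ax.
by exists (f (SigSub (mem_set Ax))); rewrite gK.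
Qed.

Lemma dense_enum (A : Type) (X : topologicalType) : density X ≲ A ->
  [set: X] !=set0 ->
  exists d : A -> X, forall O, open O -> O !=set0 -> exists a, O (d a).
Proof.
move=> dA [x _]; have [[D dD De] _] := densityP X.
have [|y [_ Dy]] := dD setT _ openT; first by exists x.
have DA : D ≲ A by rewrite card_set_leE (card_le_eql De).
have [f fS] := cardT_surj (SigSub (mem_set Dy) : D) DA.
exists (fun a => val (f a)) => O oO O0; have [z [Oz Dz]] := dD O O0 oO.
by have [a fa] := fS (SigSub (mem_set Dz)); exists a; rewrite fa.
Qed.

(* Were [G] larger than [M], one could take [G] of size [M^+ <= 2^M], so that
   the relevant coordinates embed into [set M].  Label a box [g] by points
   [m l l'] of [M] telling the coordinates [e g l] and [e g l'] apart, by the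
   traces of the coordinates on these points, and by the index of a dense point
   met by the box in each coordinate.  Boxes with the same label meet. *)
Lemma labelled_boxes I (X : I -> topologicalType) (A L M G : Type)
    (d : forall i, A -> X i) (V : G -> forall i, set (X i)) (e : G -> L -> I) :
  nat ≲ M -> A ≲ M -> (L -> M) ≲ M ->
  (forall i O, open O -> O !=set0 -> exists a, O (d i a)) ->
  (forall g i, open (V g i)) -> (forall g i, V g i !=set0) ->
  (forall g h, (forall i, V g i `&` V h i !=set0) -> g = h) ->
  (forall g i, V g i <> setT -> exists l, e g l = i) ->
  G ≲ M.
Proof.
move=> Minf AM LMM dP oV V0 Vd eV; apply/card_NltP => MG.
have /cardT_inj[s sI] : succ_card M ≲ G := (succ_cardP M).2 _ MG.
have succM : succ_card M ≲ set M.
  by apply: (succ_cardP M).2; apply/card_ltNle; exact: cantor.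
have /cardT_inj[m0 _] := Minf.
have boolM : bool ≲ M.
  by apply: card_le_trans Minf; apply: (@inj_cardT _ _ nat_of_bool) => -[] [].
have LM : L ≲ M.
  exact: card_le_trans (exp_card_le L boolM) LMM.
have MsetM : M ≲ set M.
  by apply: (@inj_cardT _ _ (fun m => [set m])) => m n /seteqP[/(_ m erefl)].
pose Q := range (fun p : succ_card M * L => e (s p.1) p.2).
have [phi phiI] : exists phi : I -> set M,
    forall x y, Q x -> Q y -> phi x = phi y -> x = y.
  apply: (card_le_funon set0); apply: card_le_trans (card_image_le _ _) _.
  apply: (prod_card_inf _ succM (card_le_trans LM MsetM)).
  exact: card_le_trans Minf MsetM.
have /choice[m mP] : forall p : succ_card M * L * L, exists m,
    e (s p.1.1) p.1.2 <> e (s p.1.1) p.2 ->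
    ~ (phi (e (s p.1.1) p.1.2) m <-> phi (e (s p.1.1) p.2) m).
  move=> -[[g l] l'] /=; have [eq|ne] := pselect (e (s g) l = e (s g) l').
    by exists (m0 0).
  apply: contrapT => nm; apply: ne; apply: phiI; [by exists (g, l)|by exists (g, l')|].
  apply/funext => n; apply/propext; apply: contrapT => h.
  by apply: nm; exists n.
have /all_sig[f fP] : forall g, {f : I -> A | forall i, V (s g) i (d i (f i))}.
  move=> g; have /(_ _)/cid-/all_sig[f fP] := fun i => dP i _ (oV (s g) i) (V0 (s g) i).
  by exists f.
pose label g := (fun l l' => m (g, l, l'),
  fun l a b => `[< phi (e (s g) l) (m (g, a, b)) >], fun l => f g (e (s g) l)).
have LLM T : T ≲ M -> (L -> T) ≲ M by move=> TM; apply: card_le_trans LMM; exact: fun_card_le.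
have : succ_card M ≲ ((L -> L -> M) * (L -> L -> L -> bool) * (L -> A))%type.
  apply: (@inj_cardT _ _ label) => g h [em ev ef]; apply/sI/Vd => i.
  have [->|Vg] := pselect (V (s g) i = setT); first by rewrite setTI.
  have [->|Vh] := pselect (V (s h) i = setT); first by rewrite setIT.
  have [l egl] := eV _ _ Vg; have [l' ehl] := eV _ _ Vh.
  have mgh a b : m (g, a, b) = m (h, a, b) := congr1 (fun k => k a b) em.
  (* The common coordinate [i] has the index [l'] in both boxes: otherwise [m (g, l, l')] tells
     [e (s g) l'] from [i], which is [e (s h) l'], against the equality of the traces. The third
     part of the label then gives one dense point for both. *)
  have egl' : e (s g) l' = i.
    rewrite -egl; apply: contrapT => /nesym/(mP (g, l, l')) /=; apply.
    have trace : `[< phi (e (s g) l') (m (g, l, l')) >] =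
        `[< phi (e (s h) l') (m (h, l, l')) >] := congr1 (fun k => k l' l l') ev.
    by have [h1 h2] := asbool_eq_equiv trace; rewrite -mgh ehl in h1 h2; rewrite egl; split.
  have := congr1 (fun k => k l') ef; rewrite egl' ehl => ei.
  by exists (d i (f g i)); split; [exact: fP|rewrite ei; exact: fP].
apply: (card_ltNle _ _).1; apply: card_le_lt_trans (succ_cardP M).1.
apply: prod_card_inf => //; last exact: LLM.
by apply: prod_card_inf => //; [exact: LLM|exact: LLM (LLM _ (LLM _ boolM))].
Qed.

(** The boxes are sorted by the cardinal [L] of their support, which gives at most [K] classes.
    [labelled_boxes] bounds each class, with [M] equal to [powlt A K] for finite [L] and to [A^L]
    for infinite [L]; in both cases [M^L] is at most [M]. *)
Lemma has_boxes_le_powlt K I (X : I -> topologicalType) (A G : Type) :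
  nat ≲ K -> bool ≲ A -> (forall i, density (X i) ≲ A) -> I ->
  (forall i, [set: X i] !=set0) -> has_boxes K X G -> G ≲ powlt A K.
Proof.
move=> Kinf A2 dX i0 X0 [V [oV V0 sV Vd]].
have /all_sig[d dP] := fun i => cid (dense_enum (dX i) (X0 i)).
have Kmu : K ≲ powlt A K := powlt_ge_exp K A2.
have muinf : nat ≲ powlt A K := card_le_trans Kinf Kmu.
have [t [f _]] : exists t f : A, t <> f.
  by have /cardT_inj[b bI] := A2; exists (b true), (b false) => /bI.
have Amu : A ≲ powlt A K.
  apply: card_le_trans (unit_fun_card_le A) _.
  exact: powlt_ge t (finite_card_lt (@finite_finset unit setT) Kinf).
have /choice[c cP] := fun g => small_cards_ex (sV g).
have /all_sig[e eP] : forall g, {e : val (c g) -> I |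
    forall i, V g i <> setT -> exists l, e l = i}.
  move=> g; apply: cid; apply: (card_le_cover i0).
  by rewrite card_set_geE -(card_le_eqr (cP g)) card_lexx.
have fib L : {g | c g = L} ≲ powlt A K.
  have /choice[eL eLP] : forall g : {g | c g = L}, exists e : val L -> I,
      forall i, V (sval g) i <> setT -> exists l, e l = i.
    by move=> [g gL] /=; subst L; exists (e g); exact: eP.
  have label M : nat ≲ M -> A ≲ M -> (val L -> M) ≲ M -> {g | c g = L} ≲ M.
    move=> Minf AM LM; apply: (labelled_boxes Minf AM LM dP _ _ _ eLP) => //.
    by move=> [g gL] [h hL] /Vd/= gh; subst h; congr exist; exact: Prop_irrelevance.
  have [Lfin|/infiniteP Linf] := pselect (finite_set [set: val L]).
    by apply: label => //; exact: finite_fun_card_le.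
  have /cardT_inj[l _] := Linf.
  apply: card_le_trans (powlt_ge_small A L); apply: label.
  - exact: card_le_trans Linf (exp_card_le _ A2).
  - by apply: (@inj_cardT _ _ (fun a _ => a)) => a b /(congr1 (fun h => h (l 0))).
  - apply: card_le_trans (curry_card _ _ _) _; apply: fun_dom_card_le => //.
    exact: cardT_square.
apply: (@card_le_trans _ _ _ [set: {L : small_cards K & {g | c g = L}}]).
  apply: (@inj_cardT _ _ (fun g => existT (fun L => {g | c g = L}) (c g) (exist _ g erefl))).
  by move=> g h /(congr1 (fun p => sval (projT2 p))).
by apply: sigT_card_inf => //; apply: card_le_trans (small_cards_le K) Kmu.
Qed.

Lemma bigcup_lt_regular (A L T : Type) (F : L -> set T) : regular_card A -> L ≺ A ->
  (forall l, F l #< [set: A]) -> \bigcup_l F l #< [set: A].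
Proof.
move=> [Ainf Acof] LA; apply: bigcup_lt_cof => //.
by apply: card_lt_le_trans LA _; rewrite (card_le_eqr Acof) card_lexx.
Qed.

(** * Delta-systems *)

(* Otherwise every small [B] extends to a small [c B] such that few [S a] meet
   [c B] only inside [B].  Iterating [c] along a well-order of [K] leaves some
   [S a] with a new point at each step, hence of size at least [K]. *)
Lemma delta_kernel_bound A K I (S : A -> set I) :
  nat ≲ K -> regular_card A -> K ≺ A -> (forall a, S a #< [set: K]) ->
  exists2 B : set I, B #< [set: A] & forall C : set I, C #< [set: A] -> B `<=` C ->
    [set: A] #<= [set a | S a `&` C `<=` B].
Proof.
move=> Kinf regA KA SK; have Ainf := regA.1; apply: contrapT => nB.
have /choice[c cP] : forall B : set I, exists C : set I, B #< [set: A] ->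
    [/\ C #< [set: A], B `<=` C & [set a | S a `&` C `<=` B] #< [set: A]].
  move=> B; have [BA|?] := pselect (B #< [set: A]); last by exists set0.
  apply: contrapT => nC; apply: nB; exists B => // C CA BC.
  by apply/card_NltP => h; apply: nC; exists C.
have [R Rwo] := wo_exists K.
pose step k (f : forall j, R j k -> set I) := [set i | exists j (h : R j k), c (f j h) i].
pose b := Fix Rwo.1 (fun=> set I) step.
have bE k : b k = [set i | exists2 j, R j k & c (b j) i].
  rewrite /b Fix_eq => [|x f f' ff']; last first.
    apply/seteqP; split=> i [j [h ci]]; exists j, h; by [rewrite -ff'|rewrite ff'].
  by apply/seteqP; split=> [i [j [h ci]]|i [j h ci]]; exists j => //; exists h.
have bA k : b k #< [set: A].
  elim/(well_founded_ind Rwo.1): k => k IH; rewrite bE.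
  pose F j := if `[< R j k >] then c (b j) else set0.
  apply: (@card_le_lt_trans _ _ _ _ (\bigcup_j F j)).
    apply: subset_card_le => i [j jk ci]; exists j => //.
    by rewrite /F asboolT.
  apply: bigcup_lt_regular => // j; rewrite /F; case: asboolP => jk.
    by have [] := cP _ (IH j jk).
  exact: finite_card_lt (finite_set0 _) Ainf.
have : \bigcup_k [set a | S a `&` c (b k) `<=` b k] #< [set: A].
  by apply: bigcup_lt_regular => // k; have [] := cP _ (bA k).
move=> /card_ltNle; apply; apply: subset_card_le => a _; apply: contrapT => na.
have /choice[t tP] : forall k, exists i, [/\ S a i, c (b k) i & ~ b k i].
  move=> k; apply: contrapT => nt; apply: na; exists k => // i [Si ci].
  by apply: contrapT => nb; apply: nt; exists i.
have tR j k : R j k -> t j <> t k.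
  move=> jk e; have [_ cj _] := tP j; have [_ _] := tP k; apply.
  by rewrite bE -e; exists j.
have /card_ltNle := SK a; apply; apply: (@card_le_injon _ _ _ _ t).
  by move=> k _; have [] := tP k.
by move=> j k _ _ e; have [/tR|//|/tR/nesym] := Rwo.2 j k.
Qed.

(** Let [G] be a maximal set of indices whose sets meet pairwise inside the kernel [B]. If [G] were
    smaller than [A], then so would be the union [C] of [B] and these sets, and the kernel property
    would give a new index. Inaccessibility leaves fewer than [A] traces on [B], so by regularity
    [A] indices in [G] share a trace, which serves as [J]. *)
Lemma delta_system A K I (S : A -> set I) :
  nat ≲ K -> regular_card A -> strongly_inaccessible K A ->
  (forall a, S a #< [set: K]) ->
  exists (J : set I) (G : set A), [/\ J #< [set: K], [set: A] #<= G &
    forall a b, G a -> G b -> a <> b -> S a `&` S b `<=` J].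
Proof.
move=> Kinf regA [KA pow] SK; have Ainf := regA.1.
have [B BA large] := delta_kernel_bound Kinf regA KA SK.
pose P : set (set A) := [set G | forall a b, G a -> G b -> a <> b -> S a `&` S b `<=` B].
have [|G [PG maxG]] := @Zorn_bigcup _ P.
  move=> Fs sub tot a b [C FC Ca] [D FD Db].
  have [CD|DC] := tot _ _ FC FD; first exact: (sub _ FD) (CD _ Ca) Db.
  exact: (sub _ FC) Ca (DC _ Db).
have AG : [set: A] #<= G.
  apply/card_NltP => GA.
  pose C := B `|` \bigcup_(a in G) S a.
  have CA : C #< [set: A].
    apply: card_ltU => //; apply: (@card_le_lt_trans _ _ _ _ (\bigcup_(a : G) S (val a))).
      apply: subset_card_le => i [a Ga Si]; by exists (SigSub (mem_set Ga)).
    apply: bigcup_lt_regular => //; first by rewrite card_set_ltE.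
    by move=> a; exact: card_lt_le_trans (SK _) (card_lt_le KA).
  have [a Ga aC] : exists2 a, ~ G a & S a `&` C `<=` B.
    apply: contrapT => na; apply: (card_ltNle _ _).1 GA _.
    apply: card_le_trans (large C CA (@subsetUl _ _ _)) _; apply: subset_card_le => a aC.
    by apply: contrapT => Ga; apply: na; exists a.
  apply: (maxG (G `|` [set a])).
    by split; [move=> x Gx; left|move=> /(_ a (or_intror erefl))].
  move=> x y [Gx|->] [Gy|->] // xy.
  - exact: PG.
  - by move=> i [Sx Sa]; apply: aC; split=> //; right; exists x.
  - by move=> i [Sa Sy]; apply: aC; split=> //; right; exists y.
(* The trace of [S a] on [B] is the range of a map from a cardinal below [K]. *)
pose T := {L : small_cards K & val L -> option B}.
have /choice[tr trP] : forall a, exists t : T, forall i,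
    (S a `&` B) i <-> exists l, omap val (projT2 t l) = Some i.
  move=> a; have [L SL] := small_cards_ex (SK a).
  have /cardT_inj[f /injective_pinv[g [gK gE]]] : S a ≲ val L.
    by rewrite card_set_leE card_set_geE (card_le_eql SL) card_lexx.
  pose h l : option B := if g l is Some x then insub (val x) else None.
  exists (existT _ L h) => i; split=> [[Si Bi]|[l]] /=.
    by exists (f (SigSub (mem_set Si))); rewrite /h gK /= insubT ?inE.
  rewrite /h; case: (g l) => //= x; case: insubP => //= u; rewrite inE => Bx eu [<-].
  by rewrite eu; split=> //; exact: set_valP.
have optA : option B ≺ A by apply: option_card_lt => //; rewrite card_set_ltE.
have TA : T ≺ A.
  have eT : [set: T] = \bigcup_(L : small_cards K) range (fun h => existT _ L h : T).
    by apply/seteqP; split=> // -[L h] _; exists L => //; exists h.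
  rewrite eT.
  apply: bigcup_lt_regular => // [|L]; first exact: card_le_lt_trans (small_cards_le K) KA.
  apply: card_le_lt_trans (card_image_le _ _) (pow _ _ optA _).
  by rewrite card_set_ltE; exact: small_cards_lt.
have : \bigcup_(t : T) [set a | G a /\ tr a = t] = G.
  by apply/seteqP; split=> [a [t _ []]//|a Ga]; exists (tr a).
have [[t ht] _|nt eG] := pselect (exists t, [set: A] #<= [set a | G a /\ tr a = t]); last first.
  exfalso; apply: (card_ltNle _ _).1 AG; rewrite -eG; apply: bigcup_lt_regular => // t.
  by apply/card_ltNle => ht; apply: nt; exists t.
have [a0 [Ga0 ta0]] : [set a | G a /\ tr a = t] !=set0.
  apply: infinite_setN0; apply/infiniteP; exact: card_le_trans Ainf ht.
exists (S a0 `&` B), [set a | G a /\ tr a = t]; split=> //.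
  by apply: card_le_lt_trans (SK a0); apply: subset_card_le => i [].
move=> a b [Ga ta] [Gb tb] ab i Sab.
have Bi := PG a b Ga Gb ab i Sab.
by apply/(trP a0); rewrite ta0 -ta; apply/(trP a); split=> //; case: Sab.
Qed.

(** * The two values of the Souslin number *)

(** The Delta-system of supports leaves [A] boxes which remain pairwise disjoint when restricted to
    a small [J], against the assumption on the product over [J]. *)
Lemma no_boxes_regular A K I (X : I -> topologicalType) (Kinf : nat ≲ K) :
  regular_card A -> strongly_inaccessible K A ->
  (forall J : set I, J !=set0 -> J #< [set: K] ->
    [set: souslin (box_product Kinf (fun j : J => X (val j)))] #= [set: A]) ->
  ~ has_boxes K X A.
Proof.
move=> regA siA SJ [V [oV V0 sV Vd]].
have [J [G [JK AG VJ]]] := delta_system Kinf regA siA sV.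
move: AG; rewrite -card_set_geE => /cardT_inj[f fI].
have fG a : G (val (f a)) := set_valP (f a).
pose W a := V (val (f a)).
have ne a b : a <> b -> val (f a) <> val (f b) by move=> ab /val_inj/fI.
have boxJ : has_boxes K (fun j : J => X (val j)) A.
  apply: (@has_boxes_restrict _ _ _ _ _ W) => //.
  - by move=> a i; exact: oV.
  - by move=> a i; exact: V0.
  - by move=> a; exact: sV.
  - by move=> a b /Vd/val_inj/fI.
  - by move=> a b /ne; exact: VJ.
have [J0|J0] := pselect (J !=set0).
  have /lt_souslin := (has_boxesP Kinf _ _).2 boxJ.
  by move=> /card_ltNle; apply; rewrite (card_le_eql (SJ J J0 JK)).
(* Over an empty [J] any two boxes meet, so there is at most one, while [A] is infinite. *)
have [V' [_ _ _ Vd']] := boxJ.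
have /cardT_inj[s sI] := regA.1.
have /sI// : s 0 = s 1.
by apply: Vd' => j; case: J0; exists (val j); exact: set_valP.
Qed.

(* By cases on where [alpha] sits:
   - [alpha <= beta^lambda] with [beta < alpha] and [lambda < kappa];
   - otherwise [kappa <= alpha]; if [cof alpha < kappa], then [alpha] embeds in
     a product of [cof alpha] smaller cardinals;
   - if [kappa <= cof alpha], then [alpha^{<kappa} = alpha], and a cellular
     family of size [alpha] comes from two coordinates when [alpha] is singular,
     from [2^{<kappa} >= kappa] when [alpha = kappa], and otherwise from the
     failure of the last condition. *)
Lemma has_boxes_powlt A K I (X : I -> topologicalType) (Kinf : nat ≲ K) :
  bool ≺ A -> K ≲ succ_card I ->
  (forall i B, B ≺ A -> has_cell B (X i)) ->
  ~ (regular_card A /\ A ≲ powlt A K /\ powlt A K ≲ A /\ strongly_inaccessible K A /\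
    (forall J : set I, J !=set0 -> J #< [set: K] ->
    [set: souslin (box_product Kinf (fun j : J => X (val j)))] #= [set: A])) ->
  has_boxes K X (powlt A K).
Proof.
move=> A2 KI cell nc.
have cell2 i : has_cell bool (X i) by exact: cell.
have Iinf : nat ≲ I by apply: infinite_of_succ; exact: card_le_trans KI.
have X0 i : [set: X i] !=set0.
  by have [U [_ U0 _]] := cell2 i; have [x _] := U0 true; exists x.
have [[B [L [BA [LK AB]]]]|nP] :=
    pselect (exists B L : Type, B ≺ A /\ L ≺ K /\ A ≲ (L -> B)).
  (* As [A] is at most [B^L], the power [A^M] is at most that of [B] to the product of [M] and [L],
     a product still smaller than [K]. *)
  apply: (@has_boxes_le _ _ _ {M : small_cards K & forall z : val M * L, B}); last first.
    apply: has_boxes_sum => // [M|i M _]; last exact: cell.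
    by apply: prod_card_lt => //; rewrite card_set_ltE; exact: small_cards_lt.
  apply: sigT_card_le => M; apply: card_le_trans (curry_card _ _ _).
  exact: fun_card_le.
have pow B L : B ≺ A -> L ≺ K -> (L -> B) ≺ A.
  by move=> BA LK; apply/card_ltNle => AB; apply: nP; exists B, L.
have KA : K ≲ A.
  apply/card_NltP => AK; apply: nP; exists bool, A; split=> //; split=> //.
  exact: exp_card_le (card_lexx _).
have Ainf : nat ≲ A := card_le_trans Kinf KA.
have [[F FA FT] _] := cofP Ainf.
have Fex a : exists l, F l a.
  have : (\bigcup_l F l) a by rewrite FT.
  by move=> [l _ Fl]; exists l.
have [cK|/card_NltP Kc] := pselect (cof A ≺ K).
  (* A function from [M] to [A] is recorded as a table: the entry at [(m, l)] is its value at [m] if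
     that lies in [F l], and [None] otherwise. *)
  apply: (@has_boxes_le _ _ _ {M : small_cards K & forall z : val M * cof A, option (F z.2)}).
    apply: sigT_card_le => M.
    apply: (@inj_cardT _ _ (fun h z => if pselect (F z.2 (h z.1)) is left k
      then Some (SigSub (mem_set k)) else None)) => g h e; apply/funext => m.
    have [l Fl] := Fex (g m).
    have := congr1 (fun k => omap val (k (m, l))) e => /=.
    by case: pselect => // p; case: pselect => // q /= [].
  apply: has_boxes_sum => // [M|i M z].
    by apply: prod_card_lt => //; rewrite card_set_ltE; exact: small_cards_lt.
  by apply/cell/option_card_lt; rewrite ?card_set_ltE.
have powA : powlt A K ≲ A.
  apply: powlt_le => // M; have MK : val M ≺ K by rewrite card_set_ltE; exact: small_cards_lt.
  apply: fun_card_lt_cof => //; first exact: card_lt_le_trans MK Kc.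
  by move=> B BA; exact: card_lt_le (pow _ _ BA MK).
apply: has_boxes_le (powA) _.
have [cA|/card_NltP Ac] := pselect (cof A ≺ A).
  have /cardT_inj[s sI] := Iinf.
  (* One coordinate selects a piece [F l] of the cover of [A], and a second one a point of this
     piece. *)
  apply: (@has_boxes_le _ _ _ {l : cof A & F l}).
    have /choice[l lP] := Fex.
    apply: (@inj_cardT _ _ (fun a => existT (fun l => F l) (l a) (SigSub (mem_set (lP a))))).
    by move=> a b /(congr1 (fun p : {l : cof A & F l} => val (projT2 p))).
  apply: (@has_boxes_factor2 _ _ _ _ _ (s 0) (s 1)) => // [/sI//|i|i l]; first exact: cell.
  by apply: cell; rewrite card_set_ltE.
have regA : regular_card A by split=> //; rewrite card_eq_le cof_card_le.
have [sKA|/card_NltP AK] := pselect (K ≺ A); last first.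
  apply: (@has_boxes_le _ _ _ {M : small_cards K & val M -> bool}).
    by apply: card_le_trans AK _; exact: powlt_ge_exp (card_lexx _).
  apply: has_boxes_sum => // M.
  by rewrite card_set_ltE; exact: small_cards_lt.
have [J [J0 [JK SJ]]] : exists J : set I, J !=set0 /\ J #< [set: K] /\
    ~ ([set: souslin (box_product Kinf (fun j : J => X (val j)))] #= [set: A]).
  apply: contrapT => nJ; apply: nc; split=> //.
  have [a _] : exists a : A, True by have /cardT_inj[s _] := Ainf; exists (s 0).
  split.
    apply: card_le_trans (unit_fun_card_le A) (powlt_ge a _).
    exact: finite_card_lt finite_finset Kinf.
  split=> //; split=> [|J J0 JK]; first by split.
  apply: contrapT => SJ; apply: nJ.
  by exists J.
apply: (has_boxes_extend X0 (J := J)); apply/(has_boxesP Kinf)/lt_souslin.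
apply/card_ltNle => SA; apply: SJ; rewrite card_eq_le SA /=.
apply/card_NltP => SltA.
(* A single factor carries cellular families of every size below [A]. If the Souslin number of the
   product over [J] were below [A], that product would have a cellular family of exactly this
   size. *)
have [j Jj] := J0.
apply: (@card_lt_irr _ [set: souslin (box_product Kinf (fun j : J => X (val j)))]).
apply/lt_souslin/has_boxesP; apply: (@has_boxes_factor _ _ _ _ (SigSub (mem_set Jj) : J)) => // i.
exact: cell.
Qed.

Theorem theorem5p23 (alpha kappa I : Type) (X : I -> topologicalType)
    (alpha_ge3 : [set: 'I_3] #<= [set: alpha])
    (kappa_inf : [set: nat] #<= [set: kappa])
    (kappa_le : [set: kappa] #<= [set: succ_card I])
    (dX : forall i, [set: density (X i)] #<= [set: alpha])
    (SX : forall i, [set: alpha] #<= [set: souslin (X i)]) :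
  let c1 := regular_card alpha in
  let c2 := [set: alpha] #= [set: powlt alpha kappa] in
  let c3 := strongly_inaccessible kappa alpha in
  let c4 := forall J : set I, J !=set0 -> J #< [set: kappa] ->
    [set: souslin (box_product kappa_inf (fun j : J => X (val j)))]
      #= [set: alpha] in
  let S_XI := souslin (box_product kappa_inf X) in
  (c1 /\ c2 /\ c3 /\ c4 ->
    [set: S_XI] #= [set: powlt alpha kappa] /\
    [set: powlt alpha kappa] #= [set: alpha]) /\
  (~ c1 \/ ~ c2 \/ ~ c3 \/ ~ c4 ->
    [set: S_XI] #= [set: succ_card (powlt alpha kappa)]).
Proof.
(* The bound [alpha >= 3] is used here: it gives two disjoint nonempty open sets in every factor. *)
have A2 : bool ≺ alpha.
  apply: card_lt_le_trans alpha_ge3; apply/card_ltNle => /cardT_inj[f fI].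
  by have := leq_card f fI; rewrite card_ord card_bool.
have cell i B : B ≺ alpha -> has_cell B (X i).
  by move=> BA; apply/lt_souslin; exact: card_lt_le_trans BA (SX i).
have X0 i : [set: X i] !=set0.
  by have [U [_ U0 _]] := cell i bool A2; have [x _] := U0 true; exists x.
have Iinf : nat ≲ I by apply: infinite_of_succ; exact: card_le_trans kappa_le.
have [i0 _] : exists i : I, True by have /cardT_inj[s _] := Iinf; exists (s 0).
move=> c1 c2 c3 c4 S_XI; split=> [[h1 [h2 [h3 h4]]]|nc].
  split; last exact/card_esym.
  apply: card_eq_trans h2; rewrite card_eq_le; apply/andP; split.
    apply/card_NltP => /lt_souslin/has_boxesP; exact: no_boxes_regular h4.
  apply/card_NltP => SA; apply: (@card_lt_irr _ [set: S_XI]).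
  apply/lt_souslin/has_boxesP; apply: (has_boxes_factor i0) => // i.
  exact: cell.
have boxes_pow : has_boxes kappa X (powlt alpha kappa).
  apply: (has_boxes_powlt (Kinf := kappa_inf)) => // -[h1 [h2 [h2' [h3 h4]]]].
  case: nc => [|[|[|]]]; apply => //.
  by rewrite /c2 card_eq_le h2.
(* The family of size [powlt alpha kappa] gives the lower bound. A Souslin number above the
   successor would give more boxes than [has_boxes_le_powlt] allows. *)
rewrite card_eq_le; apply/andP; split; last first.
  by apply: (succ_cardP _).2; apply/lt_souslin/has_boxesP.
apply/card_NltP => /lt_souslin/has_boxesP boxes_succ.
have /card_ltNle := (succ_cardP (powlt alpha kappa)).1; apply.
exact: has_boxes_le_powlt (card_lt_le A2) dX i0 X0 boxes_succ.
Qed.
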